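(* Fix $p\in(0,1/2]$, an integer $k\ge 1$, and $\epsilon>0$. Let $M_n$ be an $n\times n$ random matrix whose entries are independent $\operatorname{Ber}(p)$ random variables (each entry equals $1$ with probability $p$ and $0$ with probability $1-p$). Then there exists $n_0=n_0(p,k,\epsilon)$ such that for all $n\ge n_0$, \[\mathbb{P}[\operatorname{corank}M_n\ge k]\le (1-p+\epsilon)^{kn}.\]
   Context: $\operatorname{corank}M_n = n-\operatorname{rank}M_n$. *)

(* Defs.v *)
From HB Require Import structures.
From mathcomp Require Import all_boot all_order all_algebra.
From mathcomp Require Import reals.
Set Implicit Arguments. Unset Strict Implicit. Unset Printing Implicit Defensive.
Import Order.TTheory GRing.Theory Num.Theory.
Local Open Scope ring_scope.

Definition mx01 (R : realType) (n : nat) (A : 'M[bool]_n) : 'M[R]_n :=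
  map_mx (fun b : bool => (b : nat)%:R) A.

Definition ber_weight (R : realType) (p : R) (n : nat) (A : 'M[bool]_n) : R :=
  \prod_(i < n) \prod_(j < n) (if A i j then p else 1 - p).

Definition corank (R : realType) (n : nat) (M : 'M[R]_n) : nat := (n - \rank M)%N.

Definition prob_corank_ge (R : realType) (p : R) (n k : nat) : R :=
  \sum_(A : 'M[bool]_n | (k <= corank (mx01 R A))%N) ber_weight p A.

(* Main.v *)
(* The proof is a 2-adic version of Tikhomirov's inversion of randomness.  For
   [x] in [(Z / 2^m)^n] let [U_m(x)] be the maximum of the density, normalized
   to have mean 1, of [b . x], where [b] is a random row.  If the corank is at
   least [k], the Smith normal form yields [k] integer kernel vectors that are
   independent modulo 2.
   - If all of them have few odd entries, a union bound over their reductions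
     modulo 2 suffices, since [k] independent vectors are all orthogonal to a
     row with probability at most [(1 - p)^k].
   - Otherwise, one kernel vector [v] has many odd entries.  As [U_m(v)] at most
     doubles with [m], either [3 <= U_m(v) < 6] for some [m] with [2^m] at most
     about [(1 - p)^(-n)], or [U_m(v) < 3] at the last such scale.  In the second
     case, choose [v] as a function of [n - k] rows spanning the other [k] rows:
     each of the latter is orthogonal to [v] with probability at most [3 / 2^m].
     In the first case, take a union bound over [v] modulo [2^m]: each [v] has
     probability at most [(6 / 2^m)^n], and the proportion of vectors with many
     odd entries and [3 <= U_m] is at most [theta^n], for any fixed [theta > 0].
   For that last bound, the entries of a uniform vector are revealed one by one.
   A high moment of the density first contracts by nearly [(1 - p)^r] per step
   until it is bounded; then every odd entry contracts a power of the variance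
   by an arbitrarily small factor on average; once the variance is small, the
   part of the density above 2 lives on a small set, and its moments contract
   by an arbitrarily small factor on average. *)
Require Import Defs.
From HB Require Import structures.
From mathcomp Require Import all_boot all_order all_algebra.
From mathcomp Require Import reals.
From mathcomp Require Import boolp zify ring lra.
Import Order.TTheory GRing.Theory Num.Theory.
Local Open Scope ring_scope.
Set Implicit Arguments. Unset Strict Implicit. Unset Printing Implicit Defensive.

(** * Product measures *)

Section ProductMeasure.
Variables (R : realFieldType) (I T : finType).
Implicit Types (mu : I -> T -> R) (X : {ffun I -> T}).

Definition upd X i x : {ffun I -> T} := [ffun j => if j == i then x else X j].

Definition weight mu X : R := \prod_i mu i (X i).

Definition expect mu (F : {ffun I -> T} -> R) : R := \sum_X weight mu X * F X.

Definition prob_on mu := forall i, (forall x, 0 <= mu i x) /\ \sum_x mu i x = 1.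

Lemma weight_ge0 mu X : prob_on mu -> 0 <= weight mu X.
Proof. by move=> mP; apply: prodr_ge0 => i _; case: (mP i). Qed.

Lemma expect_prod mu (F : I -> T -> R) :
  expect mu (fun X => \prod_i F i (X i)) = \prod_i \sum_x mu i x * F i x.
Proof. by rewrite bigA_distr_bigA; apply: eq_bigr => X _; rewrite -big_split. Qed.

Lemma expect_cst mu (c : R) : prob_on mu -> expect mu (fun=> c) = c.
Proof.
move=> mP; rewrite /expect -mulr_suml -bigA_distr_bigA big1 ?mul1r // => i _.
by case: (mP i).
Qed.

Lemma eq_expect mu F1 F2 : F1 =1 F2 -> expect mu F1 = expect mu F2.
Proof. by move=> e; apply: eq_bigr => X _; rewrite e. Qed.

Lemma le_expect mu F1 F2 : prob_on mu -> (forall X, F1 X <= F2 X) ->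
  expect mu F1 <= expect mu F2.
Proof. by move=> mP le12; apply: ler_sum => X _; rewrite ler_wpM2l ?weight_ge0. Qed.

Lemma expectD mu F1 F2 :
  expect mu (fun X => F1 X + F2 X) = expect mu F1 + expect mu F2.
Proof. by rewrite -big_split; apply: eq_bigr => X _; rewrite mulrDr. Qed.

Lemma expectZ mu c F : expect mu (fun X => c * F X) = c * expect mu F.
Proof. by rewrite mulr_sumr; apply: eq_bigr => X _; rewrite mulrCA. Qed.

Lemma expect_sum mu (J : finType) (P : pred J) (F : J -> {ffun I -> T} -> R) :
  expect mu (fun X => \sum_(j | P j) F j X) = \sum_(j | P j) expect mu (F j).
Proof. by rewrite exchange_big; apply: eq_bigr => X _; rewrite mulr_sumr. Qed.

Lemma updK X i x : upd (upd X i x) i (X i) = X.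
Proof. by apply/ffunP => j; rewrite !ffunE; case: eqP => [->|]. Qed.

Lemma upd_at X i x : upd X i x i = x.
Proof. by rewrite ffunE eqxx. Qed.

Lemma upd_out X i x j : j != i -> upd X i x j = X j.
Proof. by rewrite ffunE => /negPf ->. Qed.

Lemma weight_upd mu X i x : weight mu (upd X i x) * mu i (X i) = weight mu X * mu i x.
Proof.
rewrite /weight [in LHS](bigD1 i) //= upd_at [in RHS](bigD1 i) //=.
rewrite -mulrA [RHS]mulrC; congr (_ * _); rewrite mulrC; congr (_ * _).
by apply: eq_bigr => j ji; rewrite upd_out.
Qed.

(** Exchanging coordinate [i] with an independent sample is a weight-preserving involution on pairs.
    The invariance of [F] says that its second argument does not see coordinate [i]. *)
Lemma expect_resample mu i (F : T -> {ffun I -> T} -> R) : prob_on mu ->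
    (forall x X y, F x (upd X i y) = F x X) ->
  expect mu (fun X => F (X i) X) = expect mu (fun X => \sum_x mu i x * F x X).
Proof.
move=> mP Finv; rewrite /expect.
under [RHS]eq_bigr do rewrite mulr_sumr.
rewrite pair_bigA /=.
pose g (Y : {ffun I -> T} * T) := (upd Y.1 i Y.2, Y.1 i).
have gK : involutive g by case=> X x; rewrite /g /= upd_at updK.
rewrite (reindex_inj (inv_inj gK)) /=.
rewrite -(pair_bigA _ (fun X x => weight mu (upd X i x) * (mu i (X i) * F (X i) (upd X i x)))) /=.
apply: eq_bigr => X _.
under eq_bigr do rewrite Finv mulrA weight_upd -mulrA mulrCA.
by rewrite -mulr_suml; have [_ ->] := mP i; rewrite mul1r.
Qed.

(* Conditionally on the coordinates outside [C], the factors are independent. *)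
Lemma expect_prod_cond mu (C : {set I}) (s : seq I) (F : I -> T -> {ffun I -> T} -> R) (q : R) :
    0 <= q -> prob_on mu -> uniq s -> {subset s <= C} ->
    (forall i x X, 0 <= F i x X) ->
    (forall i j X x y, j \in C -> F i x (upd X j y) = F i x X) ->
    (forall i X, i \in s -> \sum_x mu i x * F i x X <= q) ->
  expect mu (fun X => \prod_(i <- s) F i (X i) X) <= q ^+ size s.
Proof.
move=> q0 mP + + F0 Finv Fq; elim: s Fq => [|i s IHs] Fq /=.
  by move=> *; under eq_expect do rewrite big_nil; rewrite expect_cst.
move=> /andP[iNs us] sC.
have iC : i \in C by rewrite sC ?mem_head.
pose G x X := F i x X * \prod_(j <- s) F j (X j) X.
have Ginv x X y : G x (upd X i y) = G x X.
  rewrite /G Finv //; congr (_ * _); apply: eq_big_seq => j js.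
  by rewrite Finv // upd_out //; apply: contraNneq iNs => <-.
under eq_expect => X do rewrite big_cons -/(G (X i) X).
rewrite (expect_resample mP Ginv) exprS.
apply: (@le_trans _ _ (expect mu (fun X => q * \prod_(j <- s) F j (X j) X))).
  apply: le_expect => // X; rewrite /G /=.
  under eq_bigr => x _ do rewrite (mulrA (mu i x)).
  rewrite -mulr_suml ler_wpM2r ?prodr_ge0 // Fq ?mem_head //.
rewrite expectZ ler_wpM2l //; apply: IHs => //.
- by move=> j X js; apply: Fq; rewrite in_cons js orbT.
- by move=> j js; apply: sC; rewrite in_cons js orbT.
Qed.
End ProductMeasure.

(** * Averages over a finite group and one random step *)

Section Average.
Variables (R : realFieldType) (G : finZmodType).
Implicit Types (F u : G -> R).

Definition avg F : R := #|G|%:R^-1 * \sum_t F t.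

Lemma cardG_gt0 : 0 < #|G|%:R :> R.
Proof. by rewrite ltr0n; apply/card_gt0P; exists 0. Qed.

Lemma eq_avg F1 F2 : F1 =1 F2 -> avg F1 = avg F2.
Proof. by move=> e; congr (_ * _); apply: eq_bigr => t _; rewrite e. Qed.

Lemma le_avg F1 F2 : (forall t, F1 t <= F2 t) -> avg F1 <= avg F2.
Proof.
by move=> e; rewrite ler_wpM2l ?invr_ge0 ?(ltW cardG_gt0) // ler_sum.
Qed.

Lemma avg_ge0 F : (forall t, 0 <= F t) -> 0 <= avg F.
Proof. by move=> F0; rewrite mulr_ge0 ?invr_ge0 ?(ltW cardG_gt0) // sumr_ge0. Qed.

Lemma avgD F1 F2 : avg (fun t => F1 t + F2 t) = avg F1 + avg F2.
Proof. by rewrite /avg big_split mulrDr. Qed.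

Lemma avgZ c F : avg (fun t => c * F t) = c * avg F.
Proof. by rewrite /avg -mulr_sumr mulrCA. Qed.

Lemma avgN F : avg (fun t => - F t) = - avg F.
Proof. by rewrite /avg sumrN mulrN. Qed.

Lemma avgMr c F : avg (fun t => F t * c) = avg F * c.
Proof. by rewrite /avg -mulr_suml mulrA. Qed.

Lemma avg_cst c : avg (fun=> c) = c.
Proof.
by rewrite /avg sumr_const -[c *+ _]mulr_natl mulKf // gt_eqF // cardG_gt0.
Qed.

Lemma avg_sum (J : Type) (s : seq J) (F : J -> G -> R) :
  avg (fun t => \sum_(j <- s) F j t) = \sum_(j <- s) avg (F j).
Proof. by rewrite /avg exchange_big mulr_sumr. Qed.

Lemma avg_reindex (h : G -> G) F : injective h -> avg (fun t => F (h t)) = avg F.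
Proof. by move=> hI; rewrite /avg [in RHS](reindex_inj hI). Qed.

Lemma avg_shift x F : avg (fun t => F (t - x)) = avg F.
Proof. exact: avg_reindex (addIr _). Qed.

Lemma avg_refl t F : avg (fun x => F (t - x)) = avg F.
Proof. by apply: (@avg_reindex (fun x => t - x)) => x y /addrI /oppr_inj. Qed.

Lemma avg_exchange (F : G -> G -> R) :
  avg (fun t => avg (F t)) = avg (fun x => avg (fun t => F t x)).
Proof.
rewrite /avg; under eq_bigr do rewrite -/(_ * _).
by rewrite -!mulr_sumr exchange_big.
Qed.

(** For independent uniform [x] and [t], the points [t] and [t - x] are independent and uniform. *)
Lemma avg_conv (F1 F2 : G -> R) :
  avg (fun x => avg (fun t => F1 t * F2 (t - x))) = avg F1 * avg F2.
Proof.
rewrite avg_exchange -avgMr; apply: eq_avg => t.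
by rewrite avgZ avg_refl.
Qed.

Lemma le_card_avg F t : (forall t, 0 <= F t) -> F t <= #|G|%:R * avg F.
Proof.
move=> F0; rewrite /avg mulVKf ?gt_eqF ?cardG_gt0 //.
by rewrite (bigD1 t) //= lerDl sumr_ge0.
Qed.

(** Multiplying the tangent bound at [m] by [y] exceeds the next one by a nonnegative multiple of
    [(y - m) ^+ 2]. Jensen and Bernoulli inequalities are drawn from it below. *)
Lemma exprn_tangent (a : nat) (y m : R) : 0 <= y -> 0 <= m ->
  m ^+ a.+1 + a.+1%:R * m ^+ a * (y - m) <= y ^+ a.+1.
Proof.
move=> y0 m0; elim: a => [|a IHa]; first by rewrite !expr1 expr0; lra.
rewrite [y ^+ _]exprSr; apply: le_trans (ler_wpM2r y0 IHa).
rewrite -subr_ge0.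
rewrite (_ : _ - _ = a.+1%:R * m ^+ a * (y - m) ^+ 2).
  by apply: mulr_ge0; [rewrite mulr_ge0 ?exprn_ge0|rewrite sqr_ge0].
by rewrite !exprS -[in LHS]natr1; ring.
Qed.

Lemma avg_exprn_le a F : (forall t, 0 <= F t) ->
  avg F ^+ a.+1 <= avg (fun t => F t ^+ a.+1).
Proof.
move=> F0; have m0 := avg_ge0 F0.
apply: le_trans (le_avg (fun t => exprn_tangent a (F0 t) m0)).
rewrite avgD avg_cst avgZ (avgD _ (fun=> - avg F)) avg_cst subrr mulr0 addr0.
by [].
Qed.
End Average.

(** * One Bernoulli step: moments, excess and variance *)

Section Step.
Variables (R : realFieldType) (G : finZmodType) (p : R).
Hypotheses (p_ge0 : 0 <= p) (p_le : p <= 1 - p).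
Implicit Types (u : G -> R).
Local Notation q := (1 - p).

Let q_ge0 : 0 <= q. Proof. exact: le_trans p_ge0 p_le. Qed.

(** If [u] is the density of [S], this is the density of [S + x *+ b] for an independent Bernoulli
    bit [b]. *)
Definition step (x : G) u : G -> R := fun t => q * u t + p * u (t - x).

Lemma step_ge0 x u : (forall t, 0 <= u t) -> forall t, 0 <= step x u t.
Proof. by move=> u0 t; apply: addr_ge0; apply: mulr_ge0. Qed.

Lemma avg_step x u : avg (step x u) = avg u.
Proof. by rewrite avgD !avgZ avg_shift; ring. Qed.

(** If one value is at most [k] times the other, it adds at most [k] to the weight of the larger
    one, which is at most [q]. Otherwise the two are comparable. *)
Lemma mix_cases (k a b : R) : 0 <= k <= 1 -> 0 <= a -> 0 <= b ->
  [\/ q * a + p * b <= (q + k) * a, q * a + p * b <= (q + k) * b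
    | k * a < b /\ k * b < a].
Proof.
have [hp hpq] := (p_ge0, p_le); have hq := q_ge0.
move=> k01 a0 b0; have [ba|ab] := leP b (k * a); first by apply: Or31; nra.
have [ab'|ba'] := leP a (k * b); first by apply: Or32; nra.
by apply: Or33.
Qed.

(* When [a] and [b] are within a factor [k] of each other, the power is at most
   [k ^- r.+1 * (a ^+ r * b)], whose average over [b] is small. *)
Lemma exprn_mix_le (k a b : R) r : 0 < k <= 1 -> 0 <= a -> 0 <= b ->
  (q * a + p * b) ^+ r.+1 <=
    (q + k) ^+ r.+1 * (a ^+ r.+1 + b ^+ r.+1) + k^-1 ^+ r.+1 * (a ^+ r * b).
Proof.
have [hp hpq] := (p_ge0, p_le); have hq := q_ge0.
move=> /andP[k0 k1] a0 b0.
have qk0 : 0 <= q + k by lra.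
have c0 : 0 <= q * a + p * b by apply: addr_ge0; apply: mulr_ge0.
have ki0 : 0 <= k^-1 by rewrite invr_ge0 ltW.
have t3 : 0 <= k^-1 ^+ r.+1 * (a ^+ r * b) by rewrite !mulr_ge0 ?exprn_ge0.
have ta : 0 <= (q + k) ^+ r.+1 * a ^+ r.+1 by rewrite !mulr_ge0 ?exprn_ge0.
have tb : 0 <= (q + k) ^+ r.+1 * b ^+ r.+1 by rewrite !mulr_ge0 ?exprn_ge0.
have k01 : 0 <= k <= 1 by rewrite ltW.
rewrite mulrDr; case: (mix_cases k01 a0 b0) => [h|h|[h1 h2]].
- have := lerXn2r r.+1 c0 (mulr_ge0 qk0 a0) h; rewrite exprMn; lra.
- have := lerXn2r r.+1 c0 (mulr_ge0 qk0 b0) h; rewrite exprMn; lra.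
- have ka : k * a <= a by rewrite ler_piMl.
  have kb : k * b <= b by rewrite ler_piMl.
  have ha : q * a + p * b <= k^-1 * a.
    rewrite ler_pdivlMl //.
    by have := ler_wpM2l hq ka; have := ler_wpM2l hp (ltW h2); lra.
  have hb : q * a + p * b <= k^-1 * b.
    rewrite ler_pdivlMl //.
    by have := ler_wpM2l hq (ltW h1); have := ler_wpM2l hp kb; lra.
  have : (q * a + p * b) ^+ r.+1 <= (k^-1 * a) ^+ r * (k^-1 * b).
    by rewrite exprSr ler_pM ?exprn_ge0 // lerXn2r // ?nnegrE ?mulr_ge0.
  have <- : k^-1 ^+ r.+1 * (a ^+ r * b) = (k^-1 * a) ^+ r * (k^-1 * b).
    by rewrite exprMn exprSr mulrACA.
  lra.
Qed.

(** Average [exprn_mix_le] over [t] and [x]: the two pure terms each give the moment, the cross term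
    factors by [avg_conv]. Splitting at [u t <= K] trades the moment of order [r] for a small
    multiple of the next one and a constant. *)
Lemma avg_step_exprn_le (k K : R) r u : 0 < k <= 1 -> 0 < K ->
    (forall t, 0 <= u t) -> avg u = 1 ->
  avg (fun x => avg (fun t => step x u t ^+ r.+1)) <=
    (2 * (q + k) ^+ r.+1 + k^-1 ^+ r.+1 * K^-1) * avg (fun t => u t ^+ r.+1)
    + k^-1 ^+ r.+1 * K ^+ r.
Proof.
have [hp hpq] := (p_ge0, p_le); have hq := q_ge0.
move=> k01 K0 u0 u1; have ki0 : 0 <= k^-1 ^+ r.+1.
  by rewrite exprn_ge0 // invr_ge0; lra.
have /le_trans -> // :
    avg (fun x => avg (fun t => step x u t ^+ r.+1)) <=
    avg (fun x => (q + k) ^+ r.+1 * (2 * avg (fun t => u t ^+ r.+1)) +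
       k^-1 ^+ r.+1 * avg (fun t => u t ^+ r * u (t - x))).
  apply: le_avg => x.
  have -> : 2 * avg (fun t => u t ^+ r.+1) =
      avg (fun t => u t ^+ r.+1 + u (t - x) ^+ r.+1).
    by rewrite avgD (avg_shift x (fun t => u t ^+ r.+1)); ring.
  by rewrite -!avgZ -avgD; apply: le_avg => t; apply: exprn_mix_le.
rewrite avgD avg_cst avgZ (avg_conv (fun t => u t ^+ r)) u1 mulr1.
have : avg (fun t => u t ^+ r) <= avg (fun t => K^-1 * u t ^+ r.+1 + K ^+ r).
  apply: le_avg => t; have [uK|Ku] := leP (u t) K.
    apply: (@le_trans _ _ (K ^+ r)); first by rewrite lerXn2r ?nnegrE // ltW.
    by rewrite lerDr mulr_ge0 ?exprn_ge0 // invr_ge0 ltW.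
  apply: (@le_trans _ _ (K^-1 * u t ^+ r.+1)).
    by rewrite ler_pdivlMl // exprS ler_wpM2r ?exprn_ge0 // ltW.
  by rewrite lerDl exprn_ge0 // ltW.
rewrite avgD avgZ avg_cst => /(ler_wpM2l ki0); lra.
Qed.

(** Convex in [u], and supported where [u] exceeds 2, a set of small measure once the variance is
    small. *)
Definition excess u : G -> R := fun t => Num.max 0 (u t - 2).

Definition variance u : R := avg (fun t => (u t - 1) ^+ 2).

(** As for the moments, but comparable excesses are both positive, so the cross term carries the
    indicator of a positive excess at [t - x]. No additive constant remains. *)
Lemma avg_step_excess_le (k : R) r u : 0 < k <= 1 ->
  avg (fun x => avg (fun t => excess (step x u) t ^+ r.+1)) <=
    (2 * (q + k) ^+ r.+1 + k^-1 ^+ r.+1 * variance u)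
    * avg (fun t => excess u t ^+ r.+1).
Proof.
have [hp hpq] := (p_ge0, p_le); have hq := q_ge0.
move=> k01; have ki0 : 0 <= k^-1 ^+ r.+1.
  by rewrite exprn_ge0 // invr_ge0; lra.
have e0 u' t : 0 <= excess u' t by rewrite le_max lexx.
pose P t : R := (0 < excess u t)%R%:R.
have /le_trans -> // :
    avg (fun x => avg (fun t => excess (step x u) t ^+ r.+1)) <=
    avg (fun x => (q + k) ^+ r.+1 * (2 * avg (fun t => excess u t ^+ r.+1)) +
       k^-1 ^+ r.+1 * avg (fun t => excess u t ^+ r.+1 * P (t - x))).
  apply: le_avg => x.
  have -> : 2 * avg (fun t => excess u t ^+ r.+1) =
      avg (fun t => excess u t ^+ r.+1 + excess u (t - x) ^+ r.+1).
    by rewrite avgD (avg_shift x (fun t => excess u t ^+ r.+1)); ring.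
  rewrite -!avgZ -avgD; apply: le_avg => t.
  set a := excess u t; set b := excess u (t - x).
  have [a0 b0] : 0 <= a /\ 0 <= b by split; apply: e0.
  have ab0 : 0 <= q * a + p * b by apply: addr_ge0; apply: mulr_ge0.
  have : excess (step x u) t <= q * a + p * b.
    rewrite ge_max ab0 /= /step.
    have h1 : u t - 2 <= a by rewrite le_max lexx orbT.
    have h2 : u (t - x) - 2 <= b by rewrite le_max lexx orbT.
    nra.
  move=> /(lerXn2r r.+1 (e0 _ _) ab0) /le_trans -> //.
  have qk0 : 0 <= q + k by lra.
  have t3 : 0 <= k^-1 ^+ r.+1 * (a ^+ r.+1 * P (t - x)).
    by apply: mulr_ge0 => //; apply: mulr_ge0; [exact: exprn_ge0|exact: ler0n].
  have ta : 0 <= (q + k) ^+ r.+1 * a ^+ r.+1 by rewrite !mulr_ge0 ?exprn_ge0.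
  have tb : 0 <= (q + k) ^+ r.+1 * b ^+ r.+1 by rewrite !mulr_ge0 ?exprn_ge0.
  have k01' : 0 <= k <= 1 by lra.
  rewrite mulrDr; case: (mix_cases k01' a0 b0) => [h|h|[h1 h2]].
  - have := lerXn2r r.+1 ab0 (mulr_ge0 qk0 a0) h; rewrite exprMn; lra.
  - have := lerXn2r r.+1 ab0 (mulr_ge0 qk0 b0) h; rewrite exprMn; lra.
  - have ha : q * a + p * b <= k^-1 * a.
      rewrite ler_pdivlMl; last by lra.
      have ka : k * a <= a by rewrite ler_piMl //; lra.
      by have := ler_wpM2l hq ka; have := ler_wpM2l hp (ltW h2); lra.
    have b1 : P (t - x) = 1 by rewrite /P -/b (_ : 0 < b) //; nra.
    have := lerXn2r r.+1 ab0 _ ha; rewrite nnegrE b1 mulr1 exprMn => /(_ _)/le_trans -> //.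
      by rewrite mulr_ge0 // invr_ge0; lra.
    by lra.
rewrite avgD avg_cst avgZ (avg_conv (fun t => excess u t ^+ r.+1)).
(* Chebyshev: where the excess is positive, [u t - 1] is above 1. *)
have Pv : avg P <= variance u.
  apply: le_avg => t; rewrite /P lt_max ltxx /=.
  case: ltP => h; last exact: sqr_ge0.
  by rewrite /=; nra.
have E0 : 0 <= avg (fun t => excess u t ^+ r.+1).
  by apply: avg_ge0 => t; rewrite exprn_ge0.
have := ler_wpM2l (mulr_ge0 ki0 E0) Pv; lra.
Qed.

Lemma variance_ge0 u : 0 <= variance u.
Proof. by apply: avg_ge0 => t; rewrite sqr_ge0. Qed.

(** The average over [t] of [q a^2 + p b^2 - (q a + p b)^2 = q p (a - b)^2]. *)
Lemma variance_step x u : variance (step x u) =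
  variance u - q * p * avg (fun t => (u t - u (t - x)) ^+ 2).
Proof.
rewrite /variance -avgZ -avgN.
have -> : avg (fun t => (u t - 1) ^+ 2) =
    q * avg (fun t => (u t - 1) ^+ 2) + p * avg (fun t => (u (t - x) - 1) ^+ 2).
  by rewrite (avg_shift x (fun t => (u t - 1) ^+ 2)); ring.
rewrite -!avgZ -!avgD; apply: eq_avg => t; rewrite /step; ring.
Qed.

Lemma variance_step_le x u : variance (step x u) <= variance u.
Proof.
have [hp hpq] := (p_ge0, p_le); have hq := q_ge0.
rewrite variance_step gerBl; apply: mulr_ge0; first exact: mulr_ge0.
by apply: avg_ge0 => t; rewrite sqr_ge0.
Qed.
End Step.

(** * Odd steps *)

Lemma big_nat_double (V : nmodType) (F : nat -> V) n :
  \sum_(0 <= i < 2 * n) F i = \sum_(0 <= i < n) (F (2 * i)%N + F (2 * i).+1).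
Proof.
elim: n => [|n IHn]; first by rewrite muln0 !big_nil.
by rewrite mulnS add2n !big_nat_recr //= IHn addrA.
Qed.

Lemma sqr_sum_le (R : realFieldType) (F : nat -> R) n :
  (\sum_(0 <= i < n) F i) ^+ 2 <= n%:R * \sum_(0 <= i < n) F i ^+ 2.
Proof.
elim: n => [|n IHn]; first by rewrite !big_nil mul0r expr0n.
rewrite !big_nat_recr //= -natr1.
have [n0|n0] := eqVneq n 0%N; first by subst n; rewrite !big_geq //; lra.
set S := \sum_(0 <= i < n) F i in IHn *; set Q := \sum_(0 <= i < n) _ in IHn *.
have n1 : 0 < n%:R :> R by rewrite ltr0n lt0n.
suff : 2 * (S * F n) <= Q + n%:R * F n ^+ 2 by lra.
rewrite -(ler_pM2l n1); have : 0 <= (S - n%:R * F n) ^+ 2 by exact: sqr_ge0.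
lra.
Qed.

Section OddStep.
Variables (R : realFieldType) (G : finComNzRingType).

(* Both properties hold in [Z / 2^m]: odd elements are units, and a uniform
   element is even or odd with probability one half. *)
Definition halving :=
  (forall w c : G, injective (fun z => (2 * w + 1) * z + c)) /\
  (forall F : G -> R,
     avg F = 2^-1 * (avg (fun z => F (2 * z)) + avg (fun z => F (2 * z + 1)))).

Hypothesis GP : halving.
Variable h : G -> R.
Hypothesis h0 : avg h = 0.

(** The autocorrelation of [h]; at [0] it is the second moment. *)
Definition corr (e : G) : R := avg (fun t => h t * h (t - e)).
Definition corr_odd (e : G) : R := avg (fun z => corr (e * (2 * z + 1))).
Definition corr_all (e : G) : R := avg (fun y => corr (e * y)).

Lemma corr_all_split e : corr_all e = 2^-1 * (corr_all (2 * e) + corr_odd e).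
Proof.
rewrite /corr_all GP.2; congr (_ * (_ + _)).
by apply: eq_avg => z; rewrite mulrA (mulrC e).
Qed.

(** The map [z |-> (2w+1)z + w] permutes [G], and [2((2w+1)z + w) + 1 = (2w+1)(2z+1)]. *)
Lemma corr_odd_mul e w : corr_odd (e * (2 * w + 1)) = corr_odd e.
Proof.
rewrite /corr_odd -(avg_reindex (fun z => corr (e * (2 * z + 1))) (GP.1 w w)).
by apply: eq_avg => z; congr corr; ring.
Qed.

Lemma corr_all1 : corr_all 1 = 0.
Proof.
rewrite /corr_all /corr (avg_exchange (fun y t => h t * h (t - 1 * y))) -(avg_cst G (0 : R)).
apply: eq_avg => t; rewrite avgZ.
under eq_avg do rewrite mul1r.
by rewrite avg_refl h0 mulr0.
Qed.

(** Positive definiteness: this is the mean square of the averages of [h] over translates of the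
    multiples of [e]. *)
Lemma corr_all_ge0 e : 0 <= corr_all e.
Proof.
suff -> : corr_all e = avg (fun t => avg (fun y => h (t - e * y)) ^+ 2).
  by apply: avg_ge0 => t; rewrite sqr_ge0.
transitivity (avg (fun t => avg (fun y' => avg (fun y => h (t - e * y') * h (t - e * y))))).
  rewrite avg_exchange -(avg_cst G (corr_all e)); apply: eq_avg => y'.
  rewrite avg_exchange /corr_all -(avg_shift (- y')); apply: eq_avg => y.
  rewrite /corr -(avg_shift (e * y')); apply: eq_avg => t.
  by congr (_ * h _); ring.
apply: eq_avg => t; under eq_avg do rewrite avgZ.
by rewrite avgMr expr2.
Qed.

(** The double sum that arises when the square in [fejer] is expanded and averaged over odd
    multiples of [e]. *)
Definition corr_box s e : R :=
  \sum_(0 <= i < 2 ^ s) \sum_(0 <= j < 2 ^ s) corr_odd (e * (i%:R - j%:R)).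

(* Differences of opposite parity contribute [corr_odd e], the others
   reduce to [corr_box s (2 * e)]. *)
Lemma corr_box_eq s e :
  corr_box s e = 2 ^+ s * (corr 0 + 2 ^+ s * corr_all e - corr_all (2 ^+ s * e)).
Proof.
elim: s e => [|s IHs] e.
  rewrite /corr_box !big_nat1 subrr mulr0 !expr0 !mul1r addrK /corr_odd.
  by under eq_avg do rewrite mul0r; rewrite avg_cst.
have cb : corr_box s.+1 e = 2 * corr_box s (2 * e) + 2 * 4 ^+ s * corr_odd e.
  have eo (i j : nat) : corr_odd (e * (2 * (i%:R - j%:R) + 1)) = corr_odd e.
    exact: corr_odd_mul.
  have F (i j : nat) :
      [/\ corr_odd (e * ((2 * i)%:R - (2 * j)%:R)) = corr_odd (2 * e * (i%:R - j%:R)),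
          corr_odd (e * ((2 * i).+1%:R - (2 * j).+1%:R)) = corr_odd (2 * e * (i%:R - j%:R)),
          corr_odd (e * ((2 * i).+1%:R - (2 * j)%:R)) = corr_odd e &
          corr_odd (e * ((2 * i)%:R - (2 * j).+1%:R)) = corr_odd e].
    split.
    - by congr corr_odd; rewrite !natrM; ring.
    - by congr corr_odd; rewrite -!natr1 !natrM; ring.
    - by rewrite -(eo i j); congr corr_odd; rewrite -!natr1 !natrM; ring.
    - by rewrite -(corr_odd_mul e (i%:R - j%:R - 1)); congr corr_odd;
         rewrite -!natr1 !natrM; ring.
  rewrite /corr_box expnS big_nat_double.
  under eq_bigr => i _.
    rewrite !big_nat_double -big_split /=.
    under eq_bigr => j _.
      have [-> -> -> ->] := F i j.
      over.
    rewrite (_ : \sum_(0 <= j < _) _ =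
      2 * (\sum_(0 <= j < 2 ^ s) corr_odd (2 * e * (i%:R - j%:R))) +
      2 ^+ s * 2 * corr_odd e).
    over.
    rewrite !big_split /= !sumr_const_nat subn0 -[corr_odd e *+ _]mulr_natr natrX; ring.
  rewrite big_split /= -mulr_sumr sumr_const_nat subn0 -[_ *+ _ in X in _ + X]mulr_natr natrX.
  congr (_ + _); rewrite -[4%:R]/((2 * 2)%:R) natrM exprMn; ring.
rewrite cb IHs (corr_all_split e) !exprS -[4%:R]/((2 * 2)%:R) natrM exprMn.
rewrite (_ : 2 ^+ s * (2 * e) = 2 * 2 ^+ s * e); last by ring.
by field.
Qed.

Definition fejer j (x : G) : R :=
  avg (fun t => (j%:R^-1 * \sum_(0 <= i < j) h (t - i%:R * x)) ^+ 2).

(** In [corr_box_eq] at [e = 1], the term [corr_all 1] vanishes and the subtracted one is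
    nonnegative. What remains is [2 ^+ s * corr 0], against a normalization by [4 ^+ s]. *)
Lemma avg_fejer_odd s : avg (fun z => fejer (2 ^ s) (2 * z + 1)) <= (2 ^+ s)^-1 * corr 0.
Proof.
have -> : avg (fun z => fejer (2 ^ s) (2 * z + 1)) = (2 ^+ s)^-1 ^+ 2 * corr_box s 1.
  transitivity (avg (fun z => (2 ^+ s)^-1 ^+ 2 *
     \sum_(0 <= i < 2 ^ s) \sum_(0 <= j < 2 ^ s) corr ((i%:R - j%:R) * (2 * z + 1)))).
    apply: eq_avg => z; rewrite /fejer natrX.
    under eq_avg do rewrite exprMn.
    rewrite avgZ; congr (_ * _).
    under eq_avg => t.
      rewrite expr2 mulr_suml.
      under eq_bigr do rewrite mulr_sumr.
      over.
    rewrite avg_sum.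
    apply: eq_bigr => i _; rewrite avg_sum; apply: eq_bigr => j _.
    rewrite /corr -[LHS](avg_shift (- (j%:R * (2 * z + 1)))).
    by apply: eq_avg => t; rewrite [LHS]mulrC; congr (h _ * h _); ring.
  rewrite avgZ avg_sum; congr (_ * _); apply: eq_bigr => i _.
  rewrite avg_sum; apply: eq_bigr => j _; rewrite /corr_odd.
  by apply: eq_avg => z; rewrite mul1r.
rewrite corr_box_eq corr_all1 mulr1.
have s0 : 0 < 2 ^+ s :> R by rewrite exprn_gt0.
rewrite expr2 -mulrA mulKf ?gt_eqF // ler_pM2l ?invr_gt0 //.
by rewrite mulr0 addr0 gerBl corr_all_ge0.
Qed.

(** Split [h] into the average of its translates and the difference. By telescoping, a shift by [i]
    times [x] costs at most [i ^ 2] times a shift by [x] in mean square. *)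
Lemma corr_translate_le j (x : G) : (0 < j)%N ->
  corr 0 <= 2 * fejer j x + 2 * j%:R ^+ 2 * avg (fun t => (h t - h (t - x)) ^+ 2).
Proof.
move=> j0; set d := avg _.
have jR : 0 < j%:R :> R by rewrite ltr0n.
have di (i : nat) : avg (fun t => (h t - h (t - i%:R * x)) ^+ 2) <= i%:R ^+ 2 * d.
  have tel t : h t - h (t - i%:R * x) =
      \sum_(0 <= l < i) (h (t - l%:R * x) - h (t - l%:R * x - x)).
    elim: i => [|i IHi]; first by rewrite big_nil mul0r !subr0 subrr.
    rewrite big_nat_recr //= -IHi -natr1 addrA subrK; congr (_ - h _).
    by rewrite mulrDl mul1r opprD addrA.
  have /le_trans -> // : avg (fun t => (h t - h (t - i%:R * x)) ^+ 2) <=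
      avg (fun t => i%:R * \sum_(0 <= l < i) (h (t - l%:R * x) - h (t - l%:R * x - x)) ^+ 2).
    by apply: le_avg => t; rewrite tel sqr_sum_le.
  rewrite avgZ avg_sum.
  under eq_bigr => l _ do
    rewrite (avg_shift (l%:R * x) (fun t => (h t - h (t - x)) ^+ 2)).
  by rewrite sumr_const_nat subn0 -/d -[d *+ _]mulr_natl mulrA -expr2.
have ub : avg (fun t => (h t - j%:R^-1 * \sum_(0 <= i < j) h (t - i%:R * x)) ^+ 2) <=
    j%:R ^+ 2 * d.
  have eqh t : h t - j%:R^-1 * \sum_(0 <= i < j) h (t - i%:R * x) =
      j%:R^-1 * \sum_(0 <= i < j) (h t - h (t - i%:R * x)).
    rewrite sumrB sumr_const_nat subn0 -[h t *+ j]mulr_natl mulrBr mulKf //.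
    by rewrite gt_eqF.
  have /le_trans -> // : avg (fun t => (h t - j%:R^-1 * \sum_(0 <= i < j) h (t - i%:R * x)) ^+ 2) <=
      avg (fun t => j%:R^-1 * \sum_(0 <= i < j) (h t - h (t - i%:R * x)) ^+ 2).
    apply: le_avg => t; rewrite eqh exprMn expr2 -mulrA ler_wpM2l ?invr_ge0 ?ler0n //.
    by rewrite mulrC ler_pdivrMr // mulrC sqr_sum_le.
  rewrite avgZ avg_sum mulrC ler_pdivrMr //.
  apply: (@le_trans _ _ (\sum_(0 <= i < j) j%:R ^+ 2 * d)); last first.
    by rewrite sumr_const_nat subn0 -[_ * d *+ j]mulr_natr.
  apply: ler_sum_nat => i /andP[_ ij]; apply: le_trans (di i) _.
  apply: ler_wpM2r; first by apply: avg_ge0 => t; rewrite sqr_ge0.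
  by rewrite lerXn2r ?nnegrE ?ler0n // ler_nat ltnW.
have /le_trans -> // : corr 0 <= avg (fun t =>
    2 * (j%:R^-1 * \sum_(0 <= i < j) h (t - i%:R * x)) ^+ 2 +
    2 * (h t - j%:R^-1 * \sum_(0 <= i < j) h (t - i%:R * x)) ^+ 2).
  apply: le_avg => t; rewrite subr0; set w := _ * \sum_(_ <= _ < _) _.
  have := sqr_ge0 (h t - 2 * w); lra.
rewrite avgD !avgZ /fejer; lra.
Qed.
End OddStep.

(** * Revealing the entries one by one *)

Section OddStepVariance.
Variables (R : realFieldType) (G : finComNzRingType) (p : R).
Hypotheses (GP : halving R G) (p_ge0 : 0 <= p) (p_le : p <= 1 - p).

(** Take [2 ^ s] translates. Either [fejer] is at least a quarter of the variance, and its small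
    average over odd shifts yields the term [4 / 2 ^+ s]; or [h] is far from its translate, and
    [variance_step] yields a definite loss. *)
Lemma avg_variance_odd_step_le a s (u : G -> R) : avg u = 1 ->
  avg (fun z => variance (step p (2 * z + 1) u) ^+ a.+1) <=
    ((1 - (1 - p) * p / (4 * 4 ^+ s)) ^+ a.+1 + 4 / 2 ^+ s) * variance u ^+ a.+1.
Proof.
move=> u1; have [hp hpq] := (p_ge0, p_le).
pose h t := u t - 1.
have h0 : avg h = 0 by rewrite avgD u1 avg_cst subrr.
have vE : corr h 0 = variance u.
  by apply: eq_avg => t; rewrite subr0 -expr2.
set c := _ / (4 * _); have s0 : 0 < 2 ^+ s :> R by rewrite exprn_gt0.
have v0 : 0 <= variance u by exact: variance_ge0.
have four : 4 ^+ s = 2 ^+ s ^+ 2 :> R.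
  by rewrite -exprM mulnC exprM; congr (_ ^+ s); ring.
have c0 : 0 <= 1 - c.
  rewrite subr_ge0 /c ler_pdivrMr ?mulr_gt0 ?exprn_gt0 // mul1r.
  apply: (@le_trans _ _ 1); first by nra.
  have : 1 <= 4 ^+ s :> R by rewrite exprn_ege1 //; lra.
  lra.
have /le_trans -> // : avg (fun z => variance (step p (2 * z + 1) u) ^+ a.+1) <=
    avg (fun z => (1 - c) ^+ a.+1 * variance u ^+ a.+1 +
       variance u ^+ a * 4 * fejer h (2 ^ s) (2 * z + 1)).
  apply: le_avg => z; set x := 2 * z + 1; set V := fejer _ _ _.
  have V0 : 0 <= V by apply: avg_ge0 => t; rewrite sqr_ge0.
  have va : 0 <= variance u ^+ a by exact: exprn_ge0.
  have [hV|hV] := leP (variance u) (4 * V).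
    apply: (@le_trans _ _ (variance u ^+ a * 4 * V)).
      apply: (@le_trans _ _ (variance u ^+ a.+1)).
        by rewrite lerXn2r ?nnegrE ?variance_ge0 ?variance_step_le.
      by rewrite exprSr -mulrA ler_wpM2l.
    by rewrite lerDr mulr_ge0 ?exprn_ge0.
  apply: (@le_trans _ _ (((1 - c) * variance u) ^+ a.+1)); last first.
    by rewrite exprMn lerDl; apply: mulr_ge0 => //; apply: mulr_ge0.
  apply: lerXn2r; rewrite ?nnegrE ?variance_ge0 //; first exact: mulr_ge0.
  rewrite variance_step [X in _ <= X]mulrBl mul1r lerB //.
  have j0 : (0 < 2 ^ s)%N by rewrite expn_gt0.
  have := corr_translate_le h x j0; rewrite vE natrX -/V.
  rewrite (_ : avg _ = avg (fun t => (u t - u (t - x)) ^+ 2)); last first.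
    by apply: eq_avg => t; rewrite /h; congr (_ ^+ 2); ring.
  set d := avg _ => hd.
  have {hd hV} : variance u <= 4 * 4 ^+ s * d by rewrite four; lra.
  rewrite -ler_pdivrMl ?mulr_gt0 ?exprn_gt0 // => hd.
  rewrite /c -[_ / _ * _]mulrA ler_wpM2l //; apply: mulr_ge0 => //; lra.
rewrite avgD avg_cst avgZ mulrDl lerD2l exprSr.
have := avg_fejer_odd GP h0 s; rewrite vE => /(ler_wpM2l (exprn_ge0 a v0)).
lra.
Qed.
End OddStepVariance.

Section Process.
Variables (R : realFieldType) (I : finType) (G : finZmodType) (p : R).
Hypotheses (p_ge0 : 0 <= p) (p_le : p <= 1 - p).
Implicit Types (psi : I -> G -> G) (Z : {ffun I -> G}).

(* [#|G|] times the distribution of [\sum_(i <- s) b_i * x_i], the [b_i]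
   being independent Bernoulli variables of parameter [p]. *)
Definition density (x : I -> G) (s : seq I) : G -> R :=
  foldr (fun i u => step p (x i) u) (fun t => (t == 0)%:R * #|G|%:R) s.

Definition uniform : I -> G -> R := fun _ _ => #|G|%:R^-1.

Lemma uniform_prob : prob_on uniform.
Proof.
move=> i; split=> [x|]; first by rewrite invr_ge0 ltW ?cardG_gt0.
by rewrite sumr_const -[_ *+ _]mulr_natr mulVf // gt_eqF ?cardG_gt0.
Qed.

Lemma density_ge0 x s t : 0 <= density x s t.
Proof.
elim: s t => [|i s IHs] t /=; first by rewrite mulr_ge0 ?ler0n.
exact: step_ge0.
Qed.

Lemma avg_density x s : avg (density x s) = 1.
Proof.
elim: s => [|i s IHs] /=; last by rewrite avg_step.
rewrite avgMr /avg (bigD1 0) //= eqxx big1 => [|t /negPf -> //].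
by rewrite addr0 mulr1 mulVf // gt_eqF ?cardG_gt0.
Qed.

Lemma eq_density x y s : {in s, x =1 y} -> density x s = density y s.
Proof.
elim: s => //= i s IHs xy; rewrite xy ?mem_head // IHs // => j js.
by rewrite xy // in_cons js orbT.
Qed.

Lemma density_upd psi Z i z s : i \notin s ->
  density (fun j => psi j (upd Z i z j)) s = density (fun j => psi j (Z j)) s.
Proof.
move=> iNs; apply: eq_density => j js; rewrite upd_out //.
by apply: contraNneq iNs => <-.
Qed.

(** The entries of [s'] are resampled one after the other, each costing a factor [A]. As steps
    preserve [P], it is imposed after [s] only and still available at each later step. *)
Lemma expect_density_iter (P : pred (G -> R)) psi s s' (A : R) (Phi : (G -> R) -> R) :
    0 <= A -> uniq (s' ++ s) ->
    (forall u x, P u -> P (step p x u)) ->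
    (forall i u, i \in s' -> (forall t, 0 <= u t) -> avg u = 1 -> P u ->
      avg (fun z => Phi (step p (psi i z) u)) <= A * Phi u) ->
  expect uniform (fun Z => (P (density (fun i => psi i (Z i)) s))%:R *
                           Phi (density (fun i => psi i (Z i)) (s' ++ s))) <=
  A ^+ size s' *
  expect uniform (fun Z => (P (density (fun i => psi i (Z i)) s))%:R *
                           Phi (density (fun i => psi i (Z i)) s)).
Proof.
move=> A0 + Pst; elim: s' => [|i s' IHs] /=; first by rewrite expr0 mul1r.
move=> /andP[iNs us] Phi_step.
pose D Z := density (fun j => psi j (Z j)) s.
pose F z Z := (P (D Z))%:R *
   Phi (step p (psi i z) (density (fun j => psi j (Z j)) (s' ++ s))).
have Finv z Z y : F z (upd Z i y) = F z Z.
  rewrite /F /D !density_upd //.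
  by apply: contra iNs; rewrite mem_cat orbC => ->.
rewrite (expect_resample (F := F) uniform_prob Finv).
have {}IHs := IHs us (fun j u js => Phi_step j u (mem_behead (s := i :: s') js)).
rewrite exprS -mulrA; apply: le_trans (ler_wpM2l A0 IHs).
rewrite -expectZ; apply: (le_expect uniform_prob) => Z.
rewrite -mulr_sumr -mulr_sumr mulrCA [A * _]mulrCA.
case PD: (P (D Z)); last by rewrite !mul0r.
rewrite !mul1r; apply: Phi_step; first exact: mem_head.
- exact: density_ge0.
- exact: avg_density.
- by elim: (s') => //= j t; apply: Pst.
Qed.
End Process.

Section Law.
Variables (R : realFieldType) (I : finType) (p : R).
Hypotheses (p_ge0 : 0 <= p) (p_le : p <= 1 - p).

Definition bern (i : I) (b : bool) : R := if b then p else 1 - p.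

Lemma bern_prob : prob_on bern.
Proof.
move=> i; split=> [[]|]; rewrite /bern //; first exact: le_trans p_le.
by rewrite big_bool /= addrC subrK.
Qed.

(** Conditioning on the bit of the head of the list reproduces [step]. *)
Lemma density_law (G : finZmodType) (x : I -> G) s t : uniq s ->
  density p x s t =
  #|G|%:R * expect bern (fun b => (\sum_(i <- s) x i *+ b i == t)%:R).
Proof.
elim: s t => [|i s IHs] t /=.
  move=> _; have -> : expect bern (fun b => (\sum_(i <- [::]) x i *+ b i == t)%:R) = (t == 0)%:R.
    rewrite -[RHS](expect_cst _ bern_prob); apply: eq_expect => b.
    by rewrite big_nil eq_sym.
  exact: mulrC.
move=> /andP[iNs us].
pose F b0 (b : {ffun I -> bool}) : R := (x i *+ b0 + \sum_(j <- s) x j *+ b j == t)%:R.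
have Finv b0 b y : F b0 (upd b i y) = F b0 b.
  rewrite /F; congr ((_ + _ == _)%:R); apply: eq_big_seq => j js.
  by rewrite upd_out //; apply: contraNneq iNs => <-.
under eq_expect => b do rewrite big_cons -/(F (b i) b).
rewrite (expect_resample bern_prob Finv) /step !IHs //.
have -> : expect bern (fun b => \sum_x bern i x * F x b) =
    p * expect bern (F true) + (1 - p) * expect bern (F false).
  by rewrite -!expectZ -expectD; apply: eq_expect => b; rewrite big_bool.
rewrite mulrDr addrC; congr (_ + _); rewrite mulrCA; congr (_ * (_ * _)).
- apply: eq_expect => b; rewrite /F mulr1n; congr (_%:R).
  by rewrite eq_sym subr_eq eq_sym addrC.
- by apply: eq_expect => b; rewrite /F mulr0n add0r.
Qed.

(** Allows the entries to be revealed in the order that suits the phases below. *)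
Lemma perm_density (G : finZmodType) (x : I -> G) s1 s2 t :
  uniq s1 -> perm_eq s1 s2 -> density p x s1 t = density p x s2 t.
Proof.
move=> u1 s12; rewrite !density_law -?(perm_uniq s12) //; congr (_ * _).
by apply: eq_expect => b; rewrite (perm_big _ s12).
Qed.
End Law.

(** * Three-phase bound on the maximal density *)

Section Tail.
Variables (R : realFieldType) (I : finType) (G : finComNzRingType) (p : R).
Hypotheses (GP : halving R G) (p_ge0 : 0 <= p) (p_le : p <= 1 - p).
Variables (J : {set I}) (k K eta : R) (a s : nat).
Local Notation N := (#|G|%:R : R).
Local Notation q := (1 - p).
Local Notation r := (2 * a).+1.

(** The seed [z] stays uniform on [G] even for an entry forced to be odd, so a single product
    measure serves throughout. *)
Definition odd_on i z : G := if i \in J then 2 * z + 1 else z.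

Lemma exprn_convex m (x y : R) : 0 <= x -> 0 <= y ->
  (q * x + p * y) ^+ m.+1 <= q * x ^+ m.+1 + p * y ^+ m.+1.
Proof.
move=> x0 y0; have q0 : 0 <= q := le_trans p_ge0 p_le.
have m0 : 0 <= q * x + p * y by apply: addr_ge0; apply: mulr_ge0.
have := ler_wpM2l p_ge0 (exprn_tangent m y0 m0).
have := ler_wpM2l q0 (exprn_tangent m x0 m0).
set c := _%:R * _; set z := q * x + p * y.
have : q * (z ^+ m.+1 + c * (x - z)) + p * (z ^+ m.+1 + c * (y - z)) = z ^+ m.+1.
  by rewrite /z; ring.
lra.
Qed.

(** Jensen, then [|u - 1| <= max(u, 1)]. The order [r.+1] equals [2 * a.+1] for this comparison. *)
Lemma variance_exprn_le (u : G -> R) : (forall t, 0 <= u t) ->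
  variance u ^+ a.+1 <= avg (fun t => u t ^+ r.+1) + 1.
Proof.
move=> u0; apply: le_trans (avg_exprn_le _ _) _ => [t|]; first exact: sqr_ge0.
rewrite -[X in _ <= _ + X](avg_cst G) -avgD; apply: le_avg => t.
rewrite -exprM (_ : (2 * a.+1)%N = r.+1); last by lia.
have [h|h] := leP 1 (u t).
  apply: (@le_trans _ _ (u t ^+ r.+1)); last by rewrite lerDl.
  by apply: lerXn2r; rewrite ?nnegrE //; lra.
apply: (@le_trans _ _ 1); last by rewrite lerDr exprn_ge0.
rewrite (_ : r.+1 = 2 * a.+1)%N; last by lia.
rewrite exprM exprn_ile1 ?sqr_ge0 //; have := u0 t; nra.
Qed.

(** Costs of one entry: [A1] and the additive [C] for moments, [A2] for the variance at an odd
    entry, [A3] for the excess when the variance is at most [eta]. *)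
Local Notation A1 := (2 * (q + k) ^+ r.+1 + k^-1 ^+ r.+1 * K^-1).
Local Notation C := (k^-1 ^+ r.+1 * K ^+ r).
Local Notation A2 := ((1 - q * p / (4 * 4 ^+ s)) ^+ a.+1 + 4 / 2 ^+ s).
Local Notation A3 := (2 * (q + k) ^+ r.+1 + k^-1 ^+ r.+1 * eta).

(** First [#|I| - 2 * l] entries outside [J] bound the moment, then the [l] entries of [J] shrink
    the variance, then the last [l] entries shrink the excess. A final value of 3 forces a variance
    above [eta] after the second phase or a large excess; Markov bounds both. *)
Lemma expect_high_density_le (l : nat) :
    0 < k <= 1 -> 0 < K -> 0 < eta -> #|J| = l -> (2 * l <= #|I|)%N ->
    A1 <= 2^-1 -> A1 ^+ (#|I| - 2 * l) * N ^+ r <= 1 ->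
  expect (@uniform R I G) (fun Z =>
      [exists t, 3 <= density p (fun i => odd_on i (Z i)) (enum I) t]%:R) <=
  (2 + 2 * C) * (A2 ^+ l / eta ^+ a.+1 + N * A3 ^+ l).
Proof.
move=> k01 K0 eta0 Jl lI A1h A1N.
have [hp hpq] := (p_ge0, p_le); have q0 : 0 <= q := le_trans p_ge0 p_le.
have C0 : 0 <= C by rewrite mulr_ge0 ?exprn_ge0 ?invr_ge0 ?ltW //; case/andP: k01.
have k0 : 0 <= k^-1 ^+ r.+1 by rewrite exprn_ge0 ?invr_ge0 ?ltW //; case/andP: k01.
have A10 : 0 <= A1.
  apply: addr_ge0; apply: mulr_ge0 => //; last by rewrite invr_ge0 ltW.
  by rewrite exprn_ge0 //; lra.
have A30 : 0 <= A3.
  apply: addr_ge0; apply: mulr_ge0 => //; last exact: ltW.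
  by rewrite exprn_ge0 //; lra.
have A20 : 0 <= A2.
  apply: addr_ge0; last by rewrite divr_ge0 ?exprn_ge0.
  rewrite exprn_ge0 // subr_ge0 ler_pdivrMr ?mulr_gt0 ?exprn_gt0 // mul1r.
  apply: (@le_trans _ _ 1); first by nra.
  have : 1 <= 4 ^+ s :> R by rewrite exprn_ege1 //; lra.
  lra.
have UP := @uniform_prob R I G.
(* [density] folds from the right, so in [s3 ++ (s2 ++ s1)] the list [s1] is revealed first. *)
pose s2 := enum J; pose s0 := enum (~: J); pose s3 := take l s0; pose s1 := drop l s0.
have sz0 : size s0 = (#|I| - l)%N by rewrite -cardE cardsCs setCK Jl.
have sz1 : size s1 = (#|I| - 2 * l)%N by rewrite size_drop sz0 -subnDA addnn mul2n.
have sz2 : size s2 = l by rewrite -cardE.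
have sz3 : size s3 = l by rewrite size_takel // sz0; clear -lI; lia.
have s_perm : perm_eq (s3 ++ (s2 ++ s1)) (enum I).
  rewrite perm_catCA -[_ ++ s1]/(_ ++ _) cat_take_drop.
  apply: uniq_perm; rewrite ?enum_uniq //.
    rewrite cat_uniq !enum_uniq andbT /=; apply/hasPn => i.
    by rewrite !mem_enum inE.
  by move=> i; rewrite mem_cat !mem_enum inE orbN.
have us : uniq (s3 ++ (s2 ++ s1)) by rewrite (perm_uniq s_perm) enum_uniq.
have us2 : uniq (s2 ++ s1) by move: us; rewrite cat_uniq => /and3P[].
have us1 : uniq s1 by rewrite drop_uniq ?enum_uniq.
have out i : i \in s0 -> odd_on i =1 id.
  by rewrite mem_enum inE /odd_on => /negPf ->.
pose D st (Z : {ffun I -> G}) := density p (fun i => odd_on i (Z i)) st.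
pose mom (u : G -> R) := avg (fun t => u t ^+ r.+1).
have mom1 : expect (@uniform R I G) (fun Z => mom (D s1 Z)) <= 1 + 2 * C.
  (* As [A1 <= 1/2], subtracting [2 * C] turns the affine recursion for the moment into a purely
     multiplicative one. *)
  pose Phi u := mom u - 2 * C.
  have := @expect_density_iter R I G p hp hpq xpredT odd_on [::] s1 A1 Phi A10.
  rewrite cats0 => /(_ us1 (fun _ _ => id)) h.
  have {h} : expect (@uniform R I G) (fun Z => 1 * Phi (D s1 Z)) <=
      A1 ^+ size s1 * expect (@uniform R I G) (fun Z => 1 * Phi (D [::] Z)).
    apply: h => i u /mem_drop/out oi u0 u1 _; rewrite /Phi.
    under eq_avg do rewrite oi.
    rewrite avgD avg_cst; have := avg_step_exprn_le hp hpq r k01 K0 u0 u1.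
    rewrite /mom; have := ler_wpM2l C0 A1h; lra.
  rewrite !(expectZ _ 1) !mul1r /Phi !expectD !(expect_cst _ UP) sz1.
  (* The process starts from the point mass at [0], whose density is [N] there. *)
  suff -> : expect (@uniform R I G) (fun Z => mom (D [::] Z)) = N ^+ r.
    move: A1N (mulr_ge0 (exprn_ge0 (#|I| - 2 * l) A10) C0).
    move: (A1 ^+ (#|I| - 2 * l)) (N ^+ r) (C) => al nr c; lra.
  rewrite -[RHS](expect_cst _ UP); apply: eq_expect => Z.
  rewrite /mom /D /= -[in RHS](avg_cst G (N ^+ r)) /avg; congr (_ * _).
  rewrite (bigD1 0) //= eqxx big1 => [|t /negPf ->]; last by rewrite mul0r expr0n.
  by rewrite sumr_const mul1r addr0 exprSr mulr_natr.
have var2 : expect (@uniform R I G) (fun Z => variance (D (s2 ++ s1) Z) ^+ a.+1) <=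
    A2 ^+ l * (2 + 2 * C).
  pose Phi (u : G -> R) := variance u ^+ a.+1.
  have := @expect_density_iter R I G p hp hpq xpredT odd_on s1 s2 A2 Phi A20 us2.
  move=> /(_ (fun _ _ => id)) h.
  have {h} : expect (@uniform R I G) (fun Z => 1 * Phi (D (s2 ++ s1) Z)) <=
      A2 ^+ size s2 * expect (@uniform R I G) (fun Z => 1 * Phi (D s1 Z)).
    apply: h => i u; rewrite mem_enum => iJ u0 u1 _; rewrite /Phi /odd_on iJ.
    exact: avg_variance_odd_step_le.
  rewrite !(expectZ _ 1) !mul1r => /le_trans -> //; rewrite sz2 ler_wpM2l ?exprn_ge0 //.
  apply: (@le_trans _ _ (expect (@uniform R I G) (fun Z => mom (D s1 Z) + 1))).
    apply: (le_expect UP) => Z; apply: variance_exprn_le => t.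
    exact: density_ge0.
  rewrite expectD (expect_cst _ UP); lra.
(* By convexity of the power, the odd steps do not increase the moment; it will bound the excess at
   the start of the third phase. *)
have mom2 : expect (@uniform R I G) (fun Z => mom (D (s2 ++ s1) Z)) <= 1 + 2 * C.
  have := @expect_density_iter R I G p hp hpq xpredT odd_on s1 s2 1 mom ler01 us2.
  move=> /(_ (fun _ _ => id)) h.
  have {h} : expect (@uniform R I G) (fun Z => 1 * mom (D (s2 ++ s1) Z)) <=
      1 ^+ size s2 * expect (@uniform R I G) (fun Z => 1 * mom (D s1 Z)).
    apply: h => i u _ u0 u1 _; rewrite mul1r -[X in _ <= X](avg_cst G).
    apply: le_avg => z; set x := odd_on i z.
    have -> : mom u = q * mom u + p * avg (fun t => u (t - x) ^+ r.+1).
      by rewrite (avg_shift x (fun t => u t ^+ r.+1)) -/(mom u); ring.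
    by rewrite -!avgZ -avgD; apply: le_avg => t; apply: exprn_convex.
  by rewrite !(expectZ _ 1) expr1n !mul1r => /le_trans ->.
pose low (u : G -> R) := variance u <= eta.
pose exc (u : G -> R) := avg (fun t => excess u t ^+ r.+1).
have exc3 : expect (@uniform R I G) (fun Z => (low (D (s2 ++ s1) Z))%:R *
    exc (D (s3 ++ (s2 ++ s1)) Z)) <= A3 ^+ l * (1 + 2 * C).
  have := @expect_density_iter R I G p hp hpq low odd_on (s2 ++ s1) s3 A3 exc A30 us.
  rewrite sz3 => h; apply: le_trans (h _ _) _.
  - by move=> u x; apply: le_trans; apply: variance_step_le.
  - move=> i u /mem_take/out oi u0 u1 ul; rewrite /exc.
    under eq_avg do rewrite oi.
    apply: le_trans (avg_step_excess_le hp hpq r u k01) _.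
    apply: ler_wpM2r; last by rewrite lerD2l ler_wpM2l.
    by apply: avg_ge0 => t; rewrite exprn_ge0 // le_max lexx.
  rewrite ler_wpM2l ?exprn_ge0 //; apply: le_trans mom2.
  apply: (le_expect UP) => Z.
  have e_le : exc (D (s2 ++ s1) Z) <= mom (D (s2 ++ s1) Z).
    apply: le_avg => t; set u := D _ _.
    have ut : 0 <= u t by apply: density_ge0.
    apply: lerXn2r; rewrite ?nnegrE //; first by rewrite le_max lexx.
    by rewrite ge_max ut /=; lra.
  have e_ge : 0 <= exc (D (s2 ++ s1) Z).
    by apply: avg_ge0 => t; rewrite exprn_ge0 // le_max lexx.
  by case: (low _); rewrite ?mul1r ?mul0r //; apply: le_trans e_le.
have /le_trans -> // : expect (@uniform R I G) (fun Z =>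
      [exists t, 3 <= density p (fun i => odd_on i (Z i)) (enum I) t]%:R) <=
   expect (@uniform R I G) (fun Z =>
     (eta ^+ a.+1)^-1 * variance (D (s2 ++ s1) Z) ^+ a.+1 +
     N * ((low (D (s2 ++ s1) Z))%:R * exc (D (s3 ++ (s2 ++ s1)) Z))).
  apply: (le_expect UP) => Z; set u2 := D (s2 ++ s1) Z; set u3 := D (s3 ++ _) Z.
  have ea0 : 0 < eta ^+ a.+1 by rewrite exprn_gt0.
  have v0 : 0 <= variance u2 by exact: variance_ge0.
  have e0 : 0 <= exc u3.
    by apply: avg_ge0 => t; rewrite exprn_ge0 // le_max lexx.
  have t1 : 0 <= (eta ^+ a.+1)^-1 * variance u2 ^+ a.+1.
    by rewrite mulr_ge0 ?exprn_ge0 // invr_ge0 ltW.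
  have t2 : 0 <= N * ((low u2)%:R * exc u3) by do 2!apply: mulr_ge0 => //.
  case: existsP => [[t ht]|_]; last by rewrite addr_ge0.
  have [lo|hi] := leP (variance u2) eta; last first.
    suff : 1 <= (eta ^+ a.+1)^-1 * variance u2 ^+ a.+1 by rewrite /=; lra.
    by rewrite ler_pdivlMl // mulr1 lerXn2r ?nnegrE // ltW.
  (* One value is at most [N] times the average, which explains the factor [N] before the excess. *)
  have : excess u3 t ^+ r.+1 <= N * exc u3.
    by apply: (le_card_avg t) => t'; rewrite exprn_ge0 // le_max lexx.
  have : 1 <= excess u3 t ^+ r.+1.
    rewrite exprn_ege1 // le_max; apply/orP; right.
    have -> : u3 t = density p (fun i => odd_on i (Z i)) (enum I) t.
      exact: perm_density.
    lra.
  by rewrite (_ : low u2 = true) // mul1r /=; lra.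
rewrite expectD !expectZ.
have := ler_wpM2l (ltW (cardG_gt0 R G)) exc3.
have ei : 0 <= (eta ^+ a.+1)^-1 by rewrite invr_ge0 exprn_ge0 // ltW.
have := ler_wpM2l ei var2.
have := mulr_ge0 (ler0n R #|G|) (exprn_ge0 l A30).
lra.
Qed.
End Tail.

(** * Counting the vectors of high density *)

Section PowerOfTwo.
Variable m : nat.
Hypothesis m_gt0 : (0 < m)%N.
Local Notation N := (2 ^ m)%N.

Lemma exp2_gt1 : (1 < N)%N.
Proof. by rewrite -{1}(expn0 2) ltn_exp2l. Qed.

Lemma card_Z2 : #|'Z_N| = N.
Proof. by rewrite card_ord (Zp_cast exp2_gt1). Qed.

Lemma sum_Z2 (V : nmodType) (F : 'Z_N -> V) :
  \sum_y F y = \sum_(0 <= i < N) F i%:R.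
Proof.
have -> : index_iota 0 N = index_iota 0 (Zp_trunc N).+2 by rewrite (Zp_cast exp2_gt1).
rewrite big_mkord.
by apply: eq_bigr => y _; rewrite natr_Zp.
Qed.

Lemma odd_unit (w : 'Z_N) : 2 * w + 1 \is a GRing.unit.
Proof.
rewrite -(natr_Zp w) -natrM natr1 unitZpE ?exp2_gt1 //.
by rewrite coprime_pexpl // coprime2n /= mul2n odd_double.
Qed.

(** Odd residues are units. Modulo [2 ^ m], [2 * i] depends on [i] modulo [2 ^ m.-1] only, so each
    even and each odd residue is reached exactly twice. *)
Lemma halving_Z2 (R : realFieldType) : halving R 'Z_N.
Proof.
split=> [w c z1 z2 /addIr|F]; first exact: (mulrI (odd_unit w)).
rewrite /avg -mulrDr mulrCA; congr (_ * _).
have NE : N = (2 * 2 ^ m.-1)%N by rewrite -expnS prednK.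
have split_sum (F' : nat -> R) : (forall i, F' (i + 2 ^ m.-1)%N = F' i) ->
    \sum_(0 <= i < N) F' i = 2 * \sum_(0 <= i < 2 ^ m.-1) F' i.
  move=> F'N; rewrite NE mul2n -addnn.
  rewrite (@big_cat_nat _ _ _ (2 ^ m.-1)) ?leq_addr //=.
  rewrite -{2}[(2 ^ m.-1)%N]add0n big_addn addnK.
  by under [X in _ + X]eq_bigr do rewrite F'N; ring.
have NR : (2 * 2 ^ m.-1)%:R = 0 :> 'Z_N.
  by rewrite -NE; apply: pchar_Zp; exact: exp2_gt1.
rewrite !sum_Z2 (split_sum (fun i => F (2 * i%:R))); last first.
  by move=> i; rewrite natrD mulrDr -[2]/(2%:R) -(natrM _ 2 (2 ^ m.-1)) NR addr0.
rewrite (split_sum (fun i => F (2 * i%:R + 1))); last first.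
  by move=> i; rewrite natrD mulrDr -[2]/(2%:R) -(natrM _ 2 (2 ^ m.-1)) NR addr0.
rewrite -mulrDr mulKf ?pnatr_eq0 //.
have -> : index_iota 0 N = index_iota 0 (2 * 2 ^ m.-1) by rewrite NE.
rewrite big_nat_double -big_split /=.
by apply: eq_bigr => i _; rewrite -natr1 natrM.
Qed.
End PowerOfTwo.

Section Count.
Variables (R : realFieldType) (I : finType) (G : finComNzRingType).

Definition is_odd (x : G) := [exists z : G, x == 2 * z + 1].

Lemma expect_uniform (P : pred {ffun I -> G}) :
  expect (@uniform R I G) (fun Z => (P Z)%:R) = #|P|%:R / #|G|%:R ^+ #|I|.
Proof.
rewrite /expect /weight /uniform prodr_const -mulr_sumr exprVn mulrC; congr (_ / _).
rewrite -sum1_card natr_sum [RHS]big_mkcond /=.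
by apply: eq_bigr => Z _; rewrite unfold_in; case: (P Z).
Qed.

(** A vector with [l] or more odd entries is in the image of [odd_on J] for some [J] of size [l];
    the union over [J] costs at most [2 ^+ #|I|]. *)
Lemma card_odd_le (P : pred {ffun I -> G}) l (B : R) : 0 <= B ->
    (forall J : {set I}, #|J| = l ->
      expect (@uniform R I G) (fun Z => (P [ffun i => odd_on J i (Z i)])%:R) <= B) ->
  #|[pred X : {ffun I -> G} | (l <= #|[set i | is_odd (X i)]|)%N && P X]|%:R <=
    2 ^+ #|I| * B * #|G|%:R ^+ #|I|.
Proof.
move=> B0 PB; have G0 : 0 < #|G|%:R ^+ #|I| :> R by rewrite exprn_gt0 ?cardG_gt0.
pose S (J : {set I}) := [set Z : {ffun I -> G} | P [ffun i => odd_on J i (Z i)]].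
pose f (J : {set I}) (Z : {ffun I -> G}) : {ffun I -> G} := [ffun i => odd_on J i (Z i)].
have SB (J : {set I}) : #|J| = l -> #|S J|%:R <= B * #|G|%:R ^+ #|I| :> R.
  move=> /PB; rewrite expect_uniform ler_pdivrMr //; apply: le_trans.
  by rewrite ler_nat; apply: subset_leq_card; apply/subsetP => Z; rewrite inE.
set Q := [pred X | _].
have Qsub : {subset Q <= \bigcup_(J : {set I} | #|J| == l) (f J @: S J)}.
  move=> X; rewrite inE => /andP[lX PX].
  have [J JX Jl] : exists2 J : {set I}, J \subset [set i | is_odd (X i)] & #|J| = l.
    have : (0 < #|[set J : {set I} | (J \subset [set i | is_odd (X i)]) && (#|J| == l)]|)%N.
      by rewrite cards_draws bin_gt0.
    by case/card_gt0P => J; rewrite inE => /andP[? /eqP]; exists J.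
  apply/bigcupP; exists J; first exact/eqP.
  pose g i := if i \in J then odflt 0 [pick z | X i == 2 * z + 1] else X i.
  have gX i : odd_on J i (g i) = X i.
    rewrite /odd_on /g; have [iJ|//] := boolP (i \in J).
    have := subsetP JX i iJ; rewrite inE => /existsP[z Xz].
    by case: pickP => [z0 /eqP e|/(_ z)]; [rewrite /= -e|rewrite Xz].
  have fX : f J (finfun g) = X by apply/ffunP => i; rewrite !ffunE gX.
  by apply/imsetP; exists (finfun g); rewrite // inE -/(f J _) fX.
have : (#|Q| <= \sum_(J : {set I} | #|J| == l) #|S J|)%N.
  apply: leq_trans (subset_leq_card (introT subsetP Qsub)) _.
  apply: leq_trans (_ : _ <= \sum_(J : {set I} | #|J| == l) #|f J @: S J|)%N _; last first.
    by apply: leq_sum => J _; apply: leq_imset_card.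
  elim/big_rec2: _ => [|J n A _ IH]; first by rewrite cards0.
  by rewrite cardsU; apply: leq_trans (leq_subr _ _) _; rewrite leq_add2l.
rewrite -(ler_nat R) natr_sum => /le_trans; apply.
have BN0 : 0 <= B * #|G|%:R ^+ #|I| by rewrite mulr_ge0 // ltW.
apply: (@le_trans _ _ (\sum_(J : {set I}) B * #|G|%:R ^+ #|I|)).
  rewrite [X in _ <= X](bigID (fun J : {set I} => #|J| == l)) /=.
  apply: ler_wpDr; first exact: sumr_ge0.
  by apply: ler_sum => J /eqP; apply: SB.
have cS : #|{set I}| = (2 ^ #|I|)%N.
  by rewrite -[LHS]cardsT -powersetT card_powerset cardsT.
by rewrite sumr_const cS -[_ *+ (2 ^ _)]mulr_natl natrX mulrA.
Qed.
End Count.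

(** Bernoulli's inequality for [x^-1]. *)
Lemma exprn_small (R : archiRealFieldType) (x e : R) : 0 <= x < 1 -> 0 < e ->
  exists n0, forall n, (n0 <= n)%N -> x ^+ n <= e.
Proof.
move=> /andP[x0 x1] e0; have [->|xN0] := eqVneq x 0.
  by exists 1 => -[//|n] _; rewrite expr0n ltW.
have xp : 0 < x by rewrite lt_neqAle eq_sym xN0.
have y0 : 0 < x^-1 - 1 by rewrite subr_gt0 invf_gt1.
have xi0 : 0 <= x^-1 by rewrite invr_ge0.
pose b := Num.bound (e^-1 / (x^-1 - 1)); exists b.+1 => -[//|n] bn.
have : e^-1 / (x^-1 - 1) < n.+1%:R.
  apply: lt_le_trans (archi_boundP _) _; first by rewrite divr_ge0 ?invr_ge0 ?ltW.
  by rewrite ler_nat ltnW.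
rewrite ltr_pdivrMr // => h.
have := exprn_tangent n xi0 ler01; rewrite !expr1n mulr1 => h2.
have : e^-1 <= x^-1 ^+ n.+1 by lra.
by rewrite exprVn lef_pV2 // posrE exprn_gt0.
Qed.

Lemma leq_add4 a b c d : [/\ a <= a + b + c + d, b <= a + b + c + d,
  c <= a + b + c + d & d <= a + b + c + d]%N.
Proof. by split; lia. Qed.

Lemma subn_double_divn n d : (1 < d)%N ->
  (n - 2 * (n %/ d) = d.-2 * (n %/ d) + n %% d)%N.
Proof.
by case: d => [|[|d]] // _; rewrite {1}(divn_eq n d.+2) /=; lia.
Qed.

(** * Parameters of the three phases *)

Section FewStructured.
Variables (R : archiRealFieldType) (p w th : R) (D : nat).
Hypotheses (p_gt0 : 0 < p) (p_le : p <= 1 - p) (pw : 1 - p < w) (w_lt1 : w < 1).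
Hypotheses (th_gt0 : 0 < th) (th_le1 : th <= 1).
Local Notation q := (1 - p).

(** Rounding [n] down to a multiple of [d] loses fewer than [d] factors. *)
Lemma expr_slow (x : R) d n : 0 < x <= 1 -> (0 < d)%N ->
  x ^+ d ^+ (n %/ d) <= (x ^+ d)^-1 * x ^+ n.
Proof.
move=> /andP[x0 x1] d0; rewrite ler_pdivlMl ?exprn_gt0 // -exprS -exprM.
apply: ler_wiXn2l; [exact: ltW|exact: x1|].
by rewrite mulnC {1}(divn_eq n d) ltnW // mulSn addnC ltn_add2r ltn_mod.
Qed.

(** Parameters are chosen so that [n %/ d] entries in each of the last two phases already give
    [th ^+ n]; the factor [2 ^+ n] pays for the positions of the odd entries. *)
Lemma few_high_density : exists d L, [/\ (D < d)%N, 0 <= L &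
  forall n m, (0 < m)%N -> 2 ^+ m * w ^+ n <= 1 ->
  #|[pred X : {ffun 'I_n -> 'Z_(2 ^ m)} |
      (n %/ d <= #|[set i | is_odd (X i)]|)%N &&
      [exists t, 3 <= density p X (enum 'I_n) t]]|%:R <=
    L * (2 * th) ^+ n * 2 ^+ m ^+ n].
Proof.
have [hp hpq] := (p_gt0, p_le); have [hw hw1] := (pw, w_lt1).
have [t0 t1] := (th_gt0, th_le1).
have w0 : 0 < w by lra.
have [k [k0 k1 vw]] : exists k, [/\ 0 < k, k <= 1 & q + 2 * k < w].
  by exists ((w - q) / 4); split; lra.
pose v := q + 2 * k; rewrite -/v in vw.
have kv : q + k < v by rewrite /v; lra.
have v0 : 0 < v by rewrite /v; lra.
have qk0 : 0 < q + k by lra.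
have [e eP] : exists e, forall n, (e <= n)%N -> (v / w) ^+ n <= w ^+ 2.
  apply: exprn_small; last by rewrite exprn_gt0.
  by rewrite divr_ge0 ?ltW //= ltr_pdivrMr ?mul1r.
(* The first phase lacks [2 * (n %/ d)] entries; the gap between [v] and [w] compensates when [d] is
   large. *)
have [d [Dd d2 vd]] : exists d, [/\ (D < d)%N, (1 < d)%N & v ^+ d.-2 <= w ^+ d].
  exists (D + e).+2; split=> //; first by rewrite ltnS leqW ?leq_addr.
  have := eP (D + e)%N (leq_addl _ _).
  by rewrite exprMn exprVn ler_pdivrMr ?exprn_gt0 // -exprD add2n.
(* Targets for [A2] and [A3]. The extra [w ^+ d] in [T3] will absorb the group order, at most the
   inverse of [w ^+ n]. *)
pose T2 := th ^+ d; pose T3 := (th * w) ^+ d.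
have T20 : 0 < T2 by rewrite exprn_gt0.
have T30 : 0 < T3 by rewrite exprn_gt0 ?mulr_gt0.
have [s sP] : exists s, forall n, (s <= n)%N -> 2^-1 ^+ n <= T2 / 8.
  by apply: exprn_small; lra.
pose c := q * p / (4 * 4 ^+ s).
have c0 : 0 < c by rewrite divr_gt0 ?mulr_gt0 ?exprn_gt0 //; lra.
have c1 : c <= 1.
  rewrite ler_pdivrMr ?mulr_gt0 ?exprn_gt0 // mul1r.
  apply: (@le_trans _ _ 1); first by nra.
  have : 1 <= 4 ^+ s :> R by rewrite exprn_ege1 //; lra.
  lra.
have [a1 a1P] : exists a, forall n, (a <= n)%N -> ((q + k) / v) ^+ n <= 3^-1.
  apply: exprn_small; last by lra.
  by rewrite divr_ge0 ?ltW //= ltr_pdivrMr ?mul1r.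
have [a2 a2P] : exists a, forall n, (a <= n)%N -> (1 - c) ^+ n <= T2 / 2.
  by apply: exprn_small; lra.
have [a3 a3P] : exists a, forall n, (a <= n)%N -> (q + k) ^+ n <= T3 / 4.
  by apply: exprn_small; lra.
have [a4 a4P] : exists a, forall n, (a <= n)%N -> v ^+ n <= 2^-1.
  by apply: exprn_small; lra.
pose a := (a1 + a2 + a3 + a4)%N; pose r := (2 * a).+1.
have [aa1 aa2 aa3 aa4] := leq_add4 a1 a2 a3 a4; rewrite -/a in aa1 aa2 aa3 aa4.
have ar : (a <= r.+1)%N by rewrite /r mul2n -addnn -!addnS leq_addr.
(* [K] makes the cross term of [A1] equal to [(q + k) ^+ r.+1]; [eta] makes that of [A3] equal to
   [T3 / 2]. *)
pose K := k^-1 ^+ r.+1 / (q + k) ^+ r.+1.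
pose eta := k ^+ r.+1 * (T3 / 2).
have qkr : 0 < (q + k) ^+ r.+1 by rewrite exprn_gt0.
have kr : 0 < k^-1 ^+ r.+1 by rewrite exprn_gt0 ?invr_gt0.
have K0 : 0 < K by rewrite divr_gt0.
have eta0 : 0 < eta by rewrite mulr_gt0 ?exprn_gt0 //; lra.
pose A1 := 2 * (q + k) ^+ r.+1 + k^-1 ^+ r.+1 * K^-1.
pose C := k^-1 ^+ r.+1 * K ^+ r.
pose A2 := (1 - c) ^+ a.+1 + 4 / 2 ^+ s.
pose A3 := 2 * (q + k) ^+ r.+1 + k^-1 ^+ r.+1 * eta.
have A1v : A1 <= v ^+ r.+1.
  have KQ : k^-1 ^+ r.+1 * K^-1 = (q + k) ^+ r.+1.
    by rewrite /K invf_div mulrCA divff ?mulr1 // gt_eqF.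
  have -> : A1 = 3 * (q + k) ^+ r.+1 by rewrite /A1 KQ; lra.
  have := a1P r.+1; rewrite exprMn exprVn ler_pdivrMr ?exprn_gt0 // => h.
  by have := h (leq_trans aa1 ar); lra.
have vr : v ^+ r.+1 <= 2^-1 by apply: a4P; apply: leq_trans ar.
have A10 : 0 <= A1.
  by apply: addr_ge0; apply: mulr_ge0 => //; rewrite ?invr_ge0 ltW.
have A20 : 0 <= A2.
  by apply: addr_ge0; rewrite ?divr_ge0 ?exprn_ge0 //; lra.
have A2T : A2 <= T2.
  have := a2P a.+1; have := sP s (leqnn s); rewrite exprVn.
  by rewrite /A2; move=> h1 /(_ (leqW aa2)); lra.
have A30 : 0 <= A3.
  by apply: addr_ge0; apply: mulr_ge0 => //; rewrite ltW.
have A3T : A3 <= T3.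
  have : k^-1 ^+ r.+1 * eta = T3 / 2.
    by rewrite /eta mulrA exprVn mulVf ?mul1r // gt_eqF // exprn_gt0.
  by have := a3P r.+1 (leq_trans aa3 ar); rewrite /A3; lra.
have C0 : 0 <= C by rewrite mulr_ge0 ?exprn_ge0 ?invr_ge0 ?(ltW k0) ?(ltW K0).
pose L := (2 + 2 * C) * ((eta ^+ a.+1)^-1 * T2^-1 + T3^-1).
have L0 : 0 <= L.
  apply: mulr_ge0; first by lra.
  apply: addr_ge0; last by rewrite invr_ge0 ltW.
  by apply: mulr_ge0; rewrite invr_ge0 ?exprn_ge0 // ltW.
exists d, L; split=> // n m m0 Nw.
pose l := (n %/ d)%N; pose G := 'Z_(2 ^ m).
have NE : #|G|%:R = 2 ^+ m :> R by rewrite (card_Z2 m0) natrX.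
have lbound : (2 * l <= #|'I_n|)%N.
  rewrite card_ord; apply: leq_trans (leq_trunc_div n d); rewrite mulnC leq_mul2l.
  by rewrite d2 orbT.
(* The choice of [d] gives [v ^+ (n - 2 * l) <= w ^+ n], and [2 ^+ m * w ^+ n <= 1] cancels the
   initial moment. *)
have A1N : A1 ^+ (#|'I_n| - 2 * l) * (#|G|%:R) ^+ r <= 1.
  rewrite NE card_ord.
  have vn : v ^+ (n - 2 * l) <= w ^+ n.
    rewrite /l subn_double_divn // -/l.
    rewrite {2}(divn_eq n d) -/l [(l * d)%N]mulnC !exprD !exprM.
    apply: ler_pM; rewrite ?exprn_ge0 ?(ltW v0) ?(ltW w0) //.
      by apply: lerXn2r; rewrite ?nnegrE ?exprn_ge0 ?(ltW v0) ?(ltW w0).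
    by apply: lerXn2r; rewrite ?nnegrE ?(ltW v0) ?(ltW w0) // ltW.
  apply: (@le_trans _ _ ((w ^+ n) ^+ r * (2 ^+ m) ^+ r)); last first.
    by rewrite -exprMn mulrC exprn_ile1 // mulr_ge0 ?exprn_ge0 // ltW.
  apply: ler_wpM2r; first by rewrite !exprn_ge0.
  apply: (@le_trans _ _ ((v ^+ r.+1) ^+ (n - 2 * l))).
    by apply: lerXn2r; rewrite ?nnegrE ?exprn_ge0 ?(ltW v0).
  rewrite exprAC; apply: (@le_trans _ _ ((v ^+ (n - 2 * l)) ^+ r)).
    apply: ler_wiXn2l => //; first by rewrite !exprn_ge0 // ltW.
    by rewrite exprn_ile1 ?(ltW v0) //; lra.
  by apply: lerXn2r; rewrite ?nnegrE ?exprn_ge0 ?(ltW v0) ?(ltW w0).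
have p0' := ltW p_gt0.
have k01 : 0 < k <= 1 by rewrite k0.
have A1h : A1 <= 2^-1 by exact: le_trans vr.
have GP := halving_Z2 m0 R.
have := card_odd_le (R := R) (I := 'I_n) (G := G)
  (P := fun X => [exists t, 3 <= density p X (enum 'I_n) t]) (l := l)
  (B := L * th ^+ n).
have Lt : 0 <= L * th ^+ n by rewrite mulr_ge0 ?exprn_ge0 // ltW.
move=> /(_ Lt) h; apply: le_trans (h _) _; last first.
  by rewrite card_ord NE exprMn; lra.
move=> J Jl.
apply: le_trans (_ : (2 + 2 * C) * (A2 ^+ l / eta ^+ a.+1 + #|G|%:R * A3 ^+ l) <= _).
  apply: le_trans (expect_high_density_le GP p0' p_le s k01 K0 eta0 Jl lbound A1h A1N).
  apply: le_expect; first exact: uniform_prob.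
  move=> Z; rewrite ler_nat; case: existsP => // -[t ht].
  case: existsP => // -[]; exists t.
  suff <- : density p [ffun i => odd_on J i (Z i)] (enum 'I_n) =
      density p (fun i => odd_on J i (Z i)) (enum 'I_n) by [].
  by apply: eq_density => i _; rewrite ffunE.
rewrite /L -mulrA ler_wpM2l //; first by lra.
rewrite mulrDl; apply: lerD.
  rewrite mulrC -mulrA ler_wpM2l ?invr_ge0 ?exprn_ge0 ?(ltW eta0) //.
  apply: le_trans (_ : T2 ^+ l <= _).
    by apply: lerXn2r; rewrite ?nnegrE // ltW.
  by apply: expr_slow; [rewrite t0|apply: ltnW].
rewrite NE.
have : A3 ^+ l <= T3^-1 * (th * w) ^+ n.
  apply: le_trans (_ : T3 ^+ l <= _).
    by apply: lerXn2r; rewrite ?nnegrE // ltW.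
  by apply: expr_slow; [rewrite mulr_gt0 //=; nra|apply: ltnW].
move=> /(ler_wpM2l (exprn_ge0 m (ler0n R 2))) /le_trans -> //.
rewrite exprMn mulrCA ler_wpM2l ?invr_ge0 ?(ltW T30) //.
by rewrite mulrCA ler_piMr // exprn_ge0 // ltW.
Qed.
End FewStructured.

(** * Integer kernels and dependent rows *)

Section IntegerKernel.
Variables (R : realFieldType) (n k : nat).

(* The columns of the inverse of the right Smith factor that face the null
   invariant factors remain independent modulo any prime. *)
Lemma int_kernel_free (F : fieldType) (M : 'M[int]_n) :
    (k <= n - \rank (map_mx intr M : 'M[R]_n))%N ->
  exists V : 'M[int]_(k, n), M *m V^T = 0 /\ row_free (map_mx intr V : 'M[F]_(k, n)).
Proof.
have [L Lu [Q Qu [d _ ->]]] := int_Smith_normal_form M.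
set D := \matrix_(i, j) _ => kn.
pose Z := [set j : 'I_n | d`_j == 0].
pose ev (c : 'I_#|Z|) : 'I_n := enum_val c.
have kZ : (k <= #|Z|)%N.
  apply: leq_trans kn _.
  pose DR : 'M[R]_n := map_mx intr D.
  have -> : \rank (map_mx intr (L *m D *m Q) : 'M[R]_n) = \rank DR.
    have unitR (P : 'M[int]_n) : P \in unitmx -> (map_mx intr P : 'M[R]_n) \in unitmx.
      move=> Pu; have : map_mx intr P *m map_mx intr (invmx P) = 1%:M :> 'M[R]_n.
        by rewrite -map_mxM mulmxV // map_mx1.
      by case/mulmx1_unit.
    rewrite !map_mxM mxrankMfree ?row_free_unit ?unitR //.
    by rewrite eqmxMfull // row_full_unit unitR.
  rewrite -mxrank_ker.
  (* The left kernel of a diagonal matrix lives on the coordinates with zero entry, so it factors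
     through [#|Z|] columns. *)
  suff -> : kermx DR = colsub ev (kermx DR) *m rowsub ev 1%:M.
    exact: mulmx_max_rank.
  move: (kermx DR) (mulmx_ker DR) => N NDR; apply/matrixP => i l; rewrite !mxE.
  have := congr1 (fun X : 'M[R]_n => X i l) NDR; rewrite !mxE (bigD1 l) //= big1 ?addr0.
    rewrite !mxE eqxx mulr1n => /eqP Nd.
    under eq_bigr do rewrite !mxE.
    have [lZ|lZ] := boolP (l \in Z).
      have evK : ev (enum_rank_in lZ l) = l := enum_rankK_in lZ lZ.
      rewrite (bigD1 (enum_rank_in lZ l)) //=. rewrite !evK eqxx mulr1.
      rewrite big1 ?addr0 // => c cl; case: eqP => [e|]; last by rewrite mulr0.
      by case/eqP: cl; apply: enum_val_inj; exact: etrans e (esym evK).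
    move: Nd; rewrite mulf_eq0 intr_eq0; move: (lZ); rewrite inE => /negPf ->.
    rewrite orbF => /eqP ->; rewrite big1 // => c _; case: eqP => [e|]; last by rewrite mulr0.
    by case/negP: lZ; rewrite -e enum_valP.
  by move=> j; rewrite -val_eqE => /negPf jl; rewrite !mxE jl mulr0n mulr0.
pose h (c : 'I_k) : 'I_n := ev (widen_ord kZ c).
have hI : injective h by move=> x y /enum_val_inj /(congr1 val) /= /val_inj.
exists (colsub h (invmx Q))^T; split.
  rewrite trmxK -mulmxA.
  have -> : Q *m colsub h (invmx Q) = colsub h 1%:M by rewrite mulmx_colsub mulmxV.
  rewrite -mulmxA mulmx_colsub mulmx1 (_ : colsub h D = 0) ?mulmx0 //.
  apply/matrixP => i c; rewrite !mxE; case: eqP => [->|]; last by rewrite mulr0n.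
  by have := enum_valP (widen_ord kZ c); rewrite inE => /eqP; rewrite -/(h c) => ->.
apply/row_freeP; exists ((map_mx intr Q)^T *m colsub h 1%:M).
rewrite -map_trmx mulmxA -trmx_mul mulmx_colsub mulmx1.
have -> : map_mx intr Q *m map_mx intr (colsub h (invmx Q)) = colsub h 1%:M :> 'M[F]_(n, k).
  by rewrite -map_mxM mulmx_colsub mulmxV // map_mxsub map_mx1.
by apply/matrixP => i j; rewrite !mxE (inj_eq hI) eq_sym.
Qed.

(** The rows outside a basis of the row space number [n - \rank B]; any [k] of them form [C]. *)
Lemma dependent_rows (F : fieldType) (B : 'M[F]_n) : (k <= n - \rank B)%N ->
  exists2 C : {set 'I_n}, #|C| = k &
    forall v : 'cV[F]_n, (forall i, i \notin C -> row i B *m v = 0) -> B *m v = 0.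
Proof.
move=> kn; pose f := maxrankfun B.
have : (0 < #|[set C : {set 'I_n} | (C \subset ~: (f @: setT)) && (#|C| == k)]|)%N.
  rewrite cards_draws bin_gt0 cardsCs setCK card_imset; last exact: maxrankfun_inj.
  by rewrite cardsT !card_ord.
case/card_gt0P => C; rewrite inE => /andP[/subsetP sC /eqP Ck].
exists C => // v vC; have /submxP[Y ->] : (B <= rowsub f B)%MS by rewrite eq_maxrowsub.
rewrite -mulmxA (_ : rowsub f B *m v = 0) ?mulmx0 //.
apply/row_matrixP => i; rewrite row_mul row_rowsub row0; apply: vC.
by apply/negP => /sC; rewrite inE imset_f.
Qed.
End IntegerKernel.

(** * Sparse vectors and dyadic scales *)

Section Odlyzko.
Variables (R : realFieldType) (p : R) (F : fieldType) (n k : nat).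
Hypotheses (p_ge0 : 0 <= p) (p_le : p <= 1 - p).

Definition dot (V : nmodType) (m : nat) (v : 'I_m -> V) (b : 'I_m -> bool) : V :=
  \sum_i v i *+ b i.

(* Odlyzko: on [k] pivot columns, [b] is determined by its other entries. *)
Lemma prob_orthogonal_le (V : 'M[F]_(k, n)) : row_free V ->
  expect (bern p) (fun b : {ffun 'I_n -> bool} => [forall j, dot (V j) b == 0]%:R) <=
    (1 - p) ^+ k.
Proof.
move=> Vfree; have q0 : 0 <= 1 - p := le_trans p_ge0 p_le.
have VTfull : row_full V^T by rewrite /row_full mxrank_tr; exact: Vfree.
pose g (j : 'I_k) : 'I_n := fullrankfun VTfull j.
have gI : injective g by exact: fullrankfun_inj.
have Uu : rowsub g V^T \in unitmx := fullrowsub_unit VTfull.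
(* The same row space, normalized to the identity on the pivot columns. *)
pose W := (V^T *m invmx (rowsub g V^T))^T.
have Wg j j' : W j (g j') = (j == j')%:R.
  have := congr1 (fun X : 'M_k => X j' j) (mulmxV Uu).
  rewrite mul_rowsub_mx [1%:M _ _]mxE eq_sym => <-.
  by rewrite !mxE.
have WV : W = (invmx (rowsub g V^T))^T *m V by rewrite /W trmx_mul trmxK.
have dotW (b : {ffun 'I_n -> bool}) :
    [forall j, dot (V j) b == 0] -> forall j, dot (W j) b = 0.
  move=> /forallP Vb j; rewrite /dot WV.
  transitivity (\sum_l (invmx (rowsub g V^T))^T j l * dot (V l) b).
    rewrite /dot; under [RHS]eq_bigr do rewrite mulr_sumr.
    rewrite exchange_big; apply: eq_bigr => i _.
    by rewrite mxE -sumrMnl; apply: eq_bigr => l _; rewrite mulrnAr.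
  by rewrite big1 // => l _; rewrite (eqP (Vb l)) mulr0.
pose C := [set g j | j in 'I_k].
pose f j (x : bool) (X : {ffun 'I_n -> bool}) : R :=
  (x%:R + \sum_(i | i \notin C) W j i *+ X i == 0)%:R.
(* Reindexes the conditions by columns: the product has one factor at a pivot and is empty
   elsewhere. *)
pose Fi i x X := \prod_(j | g j == i) f j x X.
have FiE j x X : Fi (g j) x X = f j x X.
  by rewrite /Fi (eq_bigl (pred1 j)) ?big_pred1_eq // => j'; rewrite (inj_eq gI).
have := @expect_prod_cond R 'I_n bool (bern p) C (map g (enum 'I_k)) Fi (1 - p) q0.
rewrite size_map size_enum_ord => h; apply: le_trans _ (h _ _ _ _ _ _).
- apply: le_expect; first exact: bern_prob.
  move=> b; rewrite big_map big_enum /=.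
  case: (boolP [forall j, dot (V j) b == 0]) => [Vb|_]; last first.
    by rewrite prodr_ge0 // => j _; rewrite FiE ler0n.
  rewrite big1 // => j _; rewrite FiE /f.
  suff -> : (b (g j))%:R + \sum_(i | i \notin C) W j i *+ b i = 0 by rewrite eqxx.
  rewrite -[RHS](dotW b Vb j) /dot [RHS](bigID (mem C)) /=; congr (_ + _).
  rewrite big_imset /=; last by move=> x y _ _; apply: gI.
  rewrite (bigD1 j) //= big1 ?addr0 => [|j' jj'].
    by rewrite Wg eqxx.
  by rewrite Wg eq_sym (negPf jj') mul0rn.
- exact: bern_prob.
- by rewrite map_inj_uniq ?enum_uniq.
- by move=> _ /mapP[j _ ->]; apply: imset_f.
- by move=> i x X; apply: prodr_ge0 => j _; rewrite ler0n.
- move=> i j X x y jC; apply: eq_bigr => j' _; rewrite /f; congr ((_ + _ == 0)%:R).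
  by apply: eq_bigr => l lC; rewrite upd_out //; apply: contraNneq lC => ->.
move=> _ X /mapP[j _ ->]; rewrite big_bool /= !FiE /bern /f.
(* At most one value of the pivot bit solves the equation, and either has probability at most
   [1 - p]. *)
have [e1|_] := eqVneq (1%:R + \sum_(i | i \notin C) W j i *+ X i) 0; last first.
  by rewrite mulr0 add0r; case: eqP; rewrite ?mulr1 ?mulr0.
have [e0|_] := eqVneq (0%:R + \sum_(i | i \notin C) W j i *+ X i) 0.
  move: e1; rewrite -[X in X = 0](subr0) -{2}e0 opprD addrACA subrr addr0 subr0.
  by move/eqP; rewrite oner_eq0.
by rewrite mulr1 mulr0 addr0.
Qed.
End Odlyzko.

Section SparseCount.
Variables (R : realFieldType) (F : finFieldType) (n D : nat) (z : R).
Hypotheses (F2 : #|F| = 2%N) (z0 : 0 < z) (z1 : z <= 1) (zD : z^-1 <= (1 + z) ^+ D).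

(** Weigh each nonzero entry by [z]. All vectors together weigh [(1 + z) ^+ n], a sparse one at
    least [z ^+ (n %/ D)], and [zD] bounds the inverse of the latter by [(1 + z) ^+ n]. *)
Lemma card_sparse_le : (0 < D)%N ->
  #|[pred v : {ffun 'I_n -> F} | (#|[set i | v i != 0%R]| <= n %/ D)%N]|%:R <=
    (1 + z) ^+ (2 * n).
Proof.
move=> D0; have z1' : 1 <= 1 + z by rewrite lerDl ltW.
set S := [pred v | _].
have zi1 : 1 <= z^-1 by rewrite invf_ge1.
apply: (@le_trans _ _ (\sum_(v : {ffun 'I_n -> F})
    z^-1 ^+ (n %/ D) * \prod_i (if v i == 0 then 1 else z))).
  rewrite -sum1_card natr_sum big_mkcond /=; apply: ler_sum => v _.
  have prodE : \prod_i (if v i == 0 then 1 else z) = z ^+ #|[set i | v i != 0]|.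
    rewrite -prodr_const [RHS]big_mkcond /=; apply: eq_bigr => i _.
    by rewrite inE; case: eqP.
  rewrite prodE; case: ifP => [|_]; last by rewrite mulr_ge0 ?exprn_ge0 ?invr_ge0 ?(ltW z0).
  rewrite inE => vS; rewrite exprVn ler_pdivlMl ?exprn_gt0 // mulr1.
  by apply: ler_wiXn2l => //; apply: ltW.
rewrite -mulr_sumr -(bigA_distr_bigA (fun _ x => if x == 0 then 1 else z)) /=.
have -> : \sum_(x : F) (if x == 0 then 1 else z) = 1 + z.
  rewrite (bigD1 0) //= eqxx (eq_bigr (fun=> z)) => [|x /negPf -> //].
  rewrite sumr_const; congr (_ + _); rewrite (_ : #|_| = 1%N) //.
  by have := cardC1 (0 : F); rewrite F2.
rewrite prodr_const card_ord mul2n -addnn exprD; apply: ler_wpM2r.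
  by rewrite exprn_ge0 // (le_trans ler01).
apply: (@le_trans _ _ (((1 + z) ^+ D) ^+ (n %/ D))).
  by apply: lerXn2r; rewrite ?nnegrE ?exprn_ge0 ?(le_trans ler01).
by rewrite -exprM ler_weXn2l // mulnC leq_trunc_div.
Qed.
End SparseCount.

Section Threshold.
Variables (R : realFieldType) (p : R) (n : nat) (v : 'I_n -> int).
Hypotheses (p_ge0 : 0 <= p) (p_le : p <= 1 - p).

Definition residue m : {ffun 'I_n -> 'Z_(2 ^ m)} := [ffun i => (v i)%:~R].
(** Its maximum over [t] is [U_m(v)]. *)
Definition level m (t : 'Z_(2 ^ m)) : R := density p (residue m) (enum 'I_n) t.
Arguments level : clear implicits.

Lemma dot_residue m b : dot (residue m) b = (dot v b)%:~R.
Proof. by rewrite /dot raddf_sum; apply: eq_bigr => i _; rewrite ffunE raddfMn. Qed.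

Lemma levelE m t : level m t =
  #|'Z_(2 ^ m)|%:R * expect (bern p) (fun b : {ffun 'I_n -> bool} => ((dot v b)%:~R == t)%:R).
Proof.
rewrite /level density_law ?enum_uniq //; congr (_ * _); apply: eq_expect => b.
by rewrite big_enum -dot_residue.
Qed.

Lemma intr_Z2_eq0 m (x : int) : (0 < m)%N -> (x%:~R == 0 :> 'Z_(2 ^ m)) = ((2 ^ m)%N %| x)%Z.
Proof.
move=> m0; have m1 := exp2_gt1 m0.
have nat_case (y : nat) : (y%:R == 0 :> 'Z_(2 ^ m)) = (2 ^ m %| y)%N.
  by rewrite -val_eqE /= val_Zp_nat // /dvdn.
case: x => y; first by rewrite dvdzE nat_case.
by rewrite NegzE mulrNz oppr_eq0 dvdzE abszN nat_case.
Qed.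

(** Reducing [t] modulo [2 ^ m] can only enlarge the event, while the normalization halves. *)
Lemma level_succ m t : (0 < m)%N -> exists t', level m.+1 t <= 2 * level m t'.
Proof.
move=> m0; exists (val t)%:R; rewrite !levelE !card_Z2 // !natrX exprS -mulrA.
rewrite ler_pM2l // ler_wpM2l ?exprn_ge0 //; apply: le_expect; first exact: bern_prob.
move=> b; rewrite ler_nat.
have -> : ((dot v b)%:~R == t) = ((2 ^ m.+1)%N %| dot v b - (val t)%:Z)%Z.
  by rewrite -intr_Z2_eq0 // rmorphB /= subr_eq0 -{1}(natr_Zp t).
have -> : ((dot v b)%:~R == (val t)%:R :> 'Z_(2 ^ m)) = ((2 ^ m)%N %| dot v b - (val t)%:Z)%Z.
  by rewrite -intr_Z2_eq0 // rmorphB /= subr_eq0.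
case: (boolP (_ %| _)%Z) => // h; rewrite (dvdz_trans _ h) //.
by rewrite dvdzE /= expnS dvdn_mull.
Qed.

Lemma level_le m t : level m t <= #|'Z_(2 ^ m)|%:R.
Proof.
rewrite levelE ler_piMr ?ler0n // -[X in _ <= X](expect_cst 1 (bern_prob (I := 'I_n) p_ge0 p_le)).
apply: le_expect; first exact: bern_prob.
by move=> b; rewrite lern1 leq_b1.
Qed.

(* [level] at most doubles from one power of two to the next, so it cannot
   jump over the window [3, 6). *)
Lemma level_threshold mx : (0 < mx)%N -> [exists t, 3 <= level mx t] ->
  exists m, [/\ (0 < m <= mx)%N, [exists t, 3 <= level m t] & forall t, level m t < 6].
Proof.
elim: mx => // m IHm _ hm1.
case: m IHm hm1 => [|m] IHm hm1.
  (* Modulo 2 the density is at most 2, so the first scale cannot reach 3. *)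
  case/existsP: hm1 => t ht; have := le_trans ht (level_le t).
  by rewrite card_Z2 // expn1; lra.
have [hm|hm] := boolP [exists t, 3 <= level m.+1 t].
  have [//|m' [/andP[m0 m1] h1 h2]] := IHm _ hm.
  by exists m'; split=> //; rewrite m0 leqW.
exists m.+2; split=> [||t] //; first by rewrite /= leqnn.
 have [//|t' ht'] := @level_succ m.+1 t.
move: hm; rewrite negb_exists => /forallP/(_ t'); rewrite -ltNge; lra.
Qed.
End Threshold.
Arguments level {R} p {n} v m t.

(** * Random rows and the three alternatives *)

Section RandomRows.
Variables (R : realType) (p : R) (n : nat).
Hypotheses (p_ge0 : 0 <= p) (p_le : p <= 1 - p).
Local Notation bits := {ffun 'I_n -> bool}.
Implicit Types (M : {ffun 'I_n -> bits}) (b : bits).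

Definition row_law : 'I_n -> bits -> R := fun _ b => weight (bern p) b.

Lemma row_law_prob : prob_on row_law.
Proof.
move=> i; have BP := bern_prob (I := 'I_n) p_ge0 p_le.
split=> [b|]; first exact: weight_ge0.
have := expect_cst 1 BP; rewrite /expect.
by under eq_bigr do rewrite mulr1.
Qed.

Lemma prob_corank_geE k : prob_corank_ge p n k =
  expect row_law (fun M => (k <= corank (mx01 R (\matrix_(i, j) M i j)))%:R).
Proof.
rewrite /prob_corank_ge big_mkcond /=.
pose toM (A : 'M[bool]_n) : {ffun 'I_n -> bits} := [ffun i => [ffun j => A i j]].
pose ofM M : 'M[bool]_n := \matrix_(i, j) M i j.
have toMK : cancel toM ofM by move=> A; apply/matrixP => i j; rewrite !mxE !ffunE.
have ofMK : cancel ofM toM.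
  by move=> M; apply/ffunP => i; apply/ffunP => j; rewrite !ffunE mxE.
rewrite (reindex ofM) /=; last by exists toM => ? _; [apply: ofMK|apply: toMK].
apply: eq_bigr => M _; rewrite -/(ofM M).
have -> : ber_weight p (ofM M) = weight row_law M.
  by apply: eq_bigr => i _; apply: eq_bigr => j _; rewrite mxE.
by case: ifP; rewrite ?mulr1 ?mulr0.
Qed.

Lemma natr_forall (P : pred 'I_n) : [forall i, P i]%:R = \prod_i (P i)%:R :> R.
Proof.
have [/forallP h|] := boolP [forall i, P i].
  by rewrite big1 // => i _; rewrite h.
rewrite negb_forall => /existsP[i /negPf Pi].
by rewrite (bigD1 i) //= Pi mul0r.
Qed.

Lemma expect_all_rows (P : pred bits) :
  expect row_law (fun M => [forall i, P (M i)]%:R) =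
  expect (bern p) (fun b => (P b)%:R) ^+ n.
Proof.
under eq_expect do rewrite natr_forall.
rewrite (expect_prod row_law (fun _ b => (P b)%:R)).
by rewrite (eq_bigr (fun=> expect (bern p) (fun b => (P b)%:R))) // prodr_const card_ord.
Qed.

(** A vanishing integer product vanishes modulo [2 ^ m]. *)
Lemma prob_dot_le (v : 'I_n -> int) m c : (0 < m)%N -> (forall t, level p v m t < c) ->
  expect (bern p) (fun b => (dot v b == 0)%:R) <= c / 2 ^+ m.
Proof.
move=> m0 /(_ 0) h; rewrite ler_pdivlMr ?exprn_gt0 // mulrC.
apply: le_trans (ltW h); rewrite levelE // card_Z2 // natrX.
rewrite ler_wpM2l ?exprn_ge0 //; apply: le_expect; first exact: bern_prob.
by move=> b; rewrite ler_nat; case: eqP => // ->; rewrite eqxx.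
Qed.

(** The choice depends on the predicate alone: equal predicates give the same vector. *)
Definition some_vector (P : ('I_n -> int) -> Prop) : 'I_n -> int :=
  if pselect (exists v, P v) is left h then projT1 (cid h) else fun=> 0.

Lemma some_vectorP P : (exists v, P v) -> P (some_vector P).
Proof. by rewrite /some_vector; case: pselect => // h _; case: cid. Qed.

(** The last clause says by duality that the rows in [C] lie in the span of the others. *)
Definition dependent_on_spread m (C : {set 'I_n}) M : Prop := exists v : 'I_n -> int,
  [/\ forall i, i \notin C -> dot v (M i) = 0, forall t, level p v m t < 3 &
      forall w : 'I_n -> int, (forall i, i \notin C -> dot w (M i) = 0) ->
        forall i, dot w (M i) = 0].

(** [Y M] is a function of the rows outside [C], so conditionally on them the rows in [C] are
    independent and each is orthogonal to it with probability at most [3 / 2 ^+ m]. *)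
Lemma prob_dependent_on_spread_le m C : (0 < m)%N ->
  expect row_law (fun M => `[< dependent_on_spread m C M >]%:R) <= (3 / 2 ^+ m) ^+ #|C|.
Proof.
move=> m0; pose Q M (v : 'I_n -> int) :=
  (forall i, i \notin C -> dot v (M i) = 0) /\ forall t, level p v m t < 3.
pose Y M := some_vector (Q M).
(* The level is tested again because [Y M] is a default value when no vector satisfies [Q M]. *)
pose F (i : 'I_n) b M : R := ((dot (Y M) b == 0) && [forall t, level p (Y M) m t < 3])%:R.
have q0 : 0 <= 3 / 2 ^+ m :> R by rewrite divr_ge0 ?exprn_ge0.
have := @expect_prod_cond R 'I_n bits row_law C (enum C) F _ q0.
rewrite -cardE => h; apply: le_trans _ (h _ _ _ _ _ _).
- apply: le_expect; first exact: row_law_prob.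
  move=> M; case: asboolP => [[v [v1 v2 v3]]|_]; last by rewrite prodr_ge0 // => i _; rewrite ler0n.
  have [Y1 Y2] : Q M (Y M) by apply: some_vectorP; exists v.
  rewrite big1 // => i _; rewrite /F v3 // eqxx /=.
  by case: forallP.
- exact: row_law_prob.
- exact: enum_uniq.
- by move=> i; rewrite mem_enum.
- by move=> *; rewrite ler0n.
- move=> i j M b y jC; suff QE : Q (upd M j y) = Q M by rewrite /F /Y QE.
  apply/funext => v; apply/propext; split=> -[h1 h2]; split=> // l lC.
    by rewrite -(h1 l lC) upd_out //; apply: contraNneq lC => ->.
  by rewrite upd_out ?h1 //; apply: contraNneq lC => ->.
move=> i M _; rewrite /F; case: forallP => h2; last first.
  by rewrite big1 // => b _; rewrite andbF mulr0.
apply: le_trans (prob_dot_le m0 h2); apply: ler_sum => b _.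
by rewrite andbT.
Qed.

Lemma odd_residue (v : 'I_n -> int) m : (0 < m)%N ->
  (#|[set i | (v i)%:~R != 0%R :> 'F_2]| <= #|[set i | is_odd (residue v m i)]|)%N.
Proof.
move=> m0; apply: subset_leq_card; apply/subsetP => i; rewrite !inE => vi.
apply/existsP; exists (v i %/ 2)%Z%:~R; rewrite ffunE.
have h : (v i %% 2)%Z = 0 \/ (v i %% 2)%Z = 1.
  have := modz_ge0 (v i) (isT : 2 != 0 :> int).
  have := ltz_pmod (v i) (isT : 0 < 2 :> int).
  by move: (v i %% 2)%Z => x; lia.
move: (divz_eq (v i) 2%Z); set z := (v i %/ 2)%Z; case: h => -> e; last first.
  by rewrite e rmorphD rmorphM /= mulrC.
have two0 : 2%Z%:~R = 0 :> 'F_2 by apply/val_inj.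
by move: vi; rewrite e addr0 intrM two0 mulr0 eqxx.
Qed.

Definition spread d m := [pred X : {ffun 'I_n -> 'Z_(2 ^ m)} |
  (n %/ d <= #|[set i | is_odd (X i)]|)%N &&
  [exists t, 3 <= density p X (enum 'I_n) t]].

Definition sparse D := [pred v : {ffun 'I_n -> 'F_2} |
  (#|[set i | v i != 0%R]| <= n %/ D)%N].

(** The first two alternatives mention reductions of the kernel vectors only, and the third a set of
    rows, so each ranges over a finite set. *)
Lemma corank_ge_cases d D k mx M : (0 < D <= d)%N -> (0 < mx)%N -> (k <= n)%N ->
  (k <= corank (mx01 R (\matrix_(i, j) M i j)))%N ->
  [\/ exists V : {ffun 'I_k -> {ffun 'I_n -> 'F_2}},
        [/\ forall j, V j \in sparse D,
            row_free (\matrix_(j, l) V j l) & forall i j, dot (V j) (M i) = 0],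
      exists (m : 'I_mx.+1) (X : {ffun 'I_n -> 'Z_(2 ^ m)}),
        [/\ (0 < m)%N, X \in spread d m, forall t, density p X (enum 'I_n) t < 6 &
            forall i, dot X (M i) = 0]
    | exists2 C : {set 'I_n}, #|C| = k & dependent_on_spread mx C M].
Proof.
move=> /andP[D0 Dd] mx0 kn; set B := mx01 R _; rewrite /corank => kB.
pose MZ : 'M[int]_n := \matrix_(i, j) (M i j)%:R.
have BE : B = map_mx intr MZ.
  by apply/matrixP => i j; rewrite !mxE; case: (M i j).
have [] := @int_kernel_free R n k 'F_2 MZ; first by rewrite -BE.
move=> V [MV Vfree]; pose v j l : int := V j l.
have dotv j i : dot (v j) (M i) = 0.
  have := congr1 (fun X : 'M_(n, k) => X i j) MV; rewrite !mxE => <-.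
  apply: eq_bigr => l _; rewrite !mxE /v; case: (M i l).
    by rewrite mul1r.
  by rewrite mul0r.
pose Vb : {ffun 'I_k -> {ffun 'I_n -> 'F_2}} := [ffun j => [ffun l => (v j l)%:~R]].
have [/forallP Vs|] := boolP [forall j, Vb j \in sparse D].
  apply: Or31; exists Vb; split=> // [|i j].
    by congr row_free : Vfree; apply/matrixP => j l; rewrite !mxE !ffunE.
  rewrite /dot -[RHS](rmorph0 (intr : int -> 'F_2)) -(dotv j i) rmorph_sum.
  by apply: eq_bigr => l _; rewrite !ffunE rmorphMn.
rewrite negb_forall => /existsP[j]; rewrite inE -ltnNge => Vj.
have odd_v m : (0 < m)%N -> (n %/ d <= #|[set i | is_odd (residue (v j) m i)]|)%N.
  move=> m0; apply: leq_trans (odd_residue (v j) m0).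
  (* [D <= d] puts [n %/ d] below the sparsity threshold [n %/ D], which vector [j] exceeds. *)
  apply: leq_trans (leq_div2l n D0 Dd) (leq_trans (ltnW Vj) _).
  by apply: subset_leq_card; apply/subsetP => i; rewrite !inE !ffunE.
have [hi|lo] := boolP [exists t, 3 <= level p (v j) mx t].
  apply: Or32; have [m [/andP[m0 mmx] m3 m6]] := level_threshold p_ge0 p_le mx0 hi.
  have mmx' : (m < mx.+1)%N by [].
  exists (Ordinal mmx'), (residue (v j) m); split=> // [|i].
    by rewrite inE odd_v.
  by rewrite dot_residue dotv.
apply: Or33; have [C Ck CP] := dependent_rows kB; exists C => //.
exists (v j); split=> // [t|w wC i].
  by move: lo; rewrite negb_exists => /forallP/(_ t); rewrite -ltNge.
pose wR : 'cV[R]_n := \col_l (w l)%:~R.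
have rowE i' : row i' B *m wR = (dot w (M i'))%:~R%:M.
  apply/matrixP => x y; rewrite !ord1 !mxE eqxx mulr1n /dot rmorph_sum.
  apply: eq_bigr => l _; rewrite BE !mxE rmorphMn /=; case: (M i' l).
    by rewrite mul1r.
  by rewrite mul0r.
have := CP wR; rewrite -/B => h; have {}h := h _.
have : row i B *m wR = 0.
  rewrite -row_mul h ?row0 // => i' i'C; rewrite rowE wC //.
  by apply/matrixP => x y; rewrite !mxE mul0rn.
rewrite rowE => /(congr1 (fun X : 'M_1 => X 0 0)); rewrite !mxE mulr1n => /eqP.
by rewrite intr_eq0 => /eqP.
Qed.
End RandomRows.

(** * Union bound *)

Section UnionBound.
Variables (R : realType) (p : R) (n : nat).
Hypotheses (p_ge0 : 0 <= p) (p_le : p <= 1 - p).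

(** One union bound per alternative; in the first two, independence of the rows gives an [n]-th
    power. *)
Lemma prob_corank_ge_le d D k mx : (0 < D <= d)%N -> (0 < mx)%N -> (k <= n)%N ->
  prob_corank_ge p n k <=
    #|sparse n D|%:R ^+ k * (1 - p) ^+ (k * n)
    + \sum_(m < mx.+1 | (0 < m)%N) #|spread p n d m|%:R * (6 / 2 ^+ m) ^+ n
    + 'C(n, k)%:R * (3 / 2 ^+ mx) ^+ k.
Proof.
move=> Dd mx0 kn; rewrite prob_corank_geE; have q0 := le_trans p_ge0 p_le.
have RP := row_law_prob (n := n) p_ge0 p_le; have BP := bern_prob (I := 'I_n) p_ge0 p_le.
pose SA := [pred V : {ffun 'I_k -> {ffun 'I_n -> 'F_2}} |
  (V \in ffun_on (mem (sparse n D))) && row_free (\matrix_(j, l) V j l)].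
pose IA (M : {ffun 'I_n -> {ffun 'I_n -> bool}}) : R :=
  \sum_(V in SA) [forall i, [forall j, dot (V j) (M i) == 0]]%:R.
pose SB m := [pred X : {ffun 'I_n -> 'Z_(2 ^ m)} |
  (X \in spread p n d m) && [forall t, density p X (enum 'I_n) t < 6]].
pose IB (M : {ffun 'I_n -> {ffun 'I_n -> bool}}) : R :=
  \sum_(m < mx.+1 | (0 < m)%N) \sum_(X in SB m) [forall i, dot X (M i) == 0]%:R.
pose IC (M : {ffun 'I_n -> {ffun 'I_n -> bool}}) : R :=
  \sum_(C : {set 'I_n} | #|C| == k) `[< dependent_on_spread p mx C M >]%:R.
apply: (@le_trans _ _ (expect (row_law p (n := n)) (fun M => IA M + IB M + IC M))).
  apply: le_expect => // M.
  have A0 : 0 <= IA M by apply: sumr_ge0 => *; rewrite ler0n.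
  have B0 : 0 <= IB M by do 2!apply: sumr_ge0 => * ; rewrite ler0n.
  have C0 : 0 <= IC M by apply: sumr_ge0 => *; rewrite ler0n.
  case: (boolP (k <= _)%N) => [kc|_]; last by rewrite !addr_ge0.
  case: (corank_ge_cases p_ge0 p_le Dd mx0 kn kc).
  - move=> [V [Vs Vf V0]]; suff : 1 <= IA M by rewrite /=; lra.
    have VS : V \in SA by rewrite inE Vf andbT; apply/ffun_onP.
    rewrite /IA (bigD1 V) //= (_ : [forall i, _] = true); last first.
      by apply/forallP => i; apply/forallP => j; rewrite V0.
    by rewrite lerDl sumr_ge0 // => *; rewrite ler0n.
  - move=> [m [X [m0 Xs X6 X0]]]; suff : 1 <= IB M by rewrite /=; lra.
    have XS : X \in SB m by rewrite inE Xs; apply/forallP.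
    rewrite /IB (bigD1 m) //= (bigD1 X) //= (_ : [forall i, _] = true); last first.
      by apply/forallP => i; rewrite X0.
    rewrite -addrA lerDl; apply: addr_ge0; apply: sumr_ge0 => m' _.
      by rewrite ler0n.
    by apply: sumr_ge0 => *; rewrite ler0n.
  - move=> [C Ck CP]; suff : 1 <= IC M by rewrite /=; lra.
    rewrite /IC (bigD1 C) ?Ck //= (_ : `[< _ >] = true); last exact/asboolP.
    by rewrite lerDl sumr_ge0 // => *; rewrite ler0n.
rewrite !expectD; apply: lerD; first apply: lerD.
- rewrite /IA expect_sum.
  apply: (@le_trans _ _ (\sum_(V in SA) (1 - p) ^+ (k * n))).
    apply: ler_sum => V; rewrite inE => /andP[_ Vf].
    rewrite (expect_all_rows p (fun b => [forall j, dot (V j) b == 0])) exprM.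
    apply: lerXn2r; rewrite ?nnegrE ?exprn_ge0 //.
      by apply: sumr_ge0 => b _; rewrite mulr_ge0 ?weight_ge0.
    apply: le_trans (prob_orthogonal_le p_ge0 p_le Vf); apply: le_expect => // b.
    rewrite ler_nat; case: forallP => // h; rewrite lt0b; apply/forallP => j.
    by rewrite -(eqP (h j)) /dot; apply/eqP; apply: eq_bigr => l _; rewrite mxE.
  rewrite sumr_const -[_ *+ #|_|]mulr_natl ler_wpM2r ?exprn_ge0 // -natrX ler_nat.
  have <- : #|ffun_on (mem (sparse n D)) : {pred {ffun 'I_k -> _}}| = (#|sparse n D| ^ k)%N.
    by rewrite card_ffun_on card_ord.
  by apply: subset_leq_card; apply/subsetP => V; rewrite !inE => /andP[].
- rewrite /IB expect_sum; apply: ler_sum => m m0; rewrite expect_sum.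
  apply: (@le_trans _ _ (\sum_(X in SB m) (6 / 2 ^+ m) ^+ n)).
    apply: ler_sum => X; rewrite inE => /andP[_ /forallP X6].
    rewrite (expect_all_rows p (fun b => dot X b == 0)).
    apply: lerXn2r; rewrite ?nnegrE ?divr_ge0 ?exprn_ge0 //.
      by apply: sumr_ge0 => b _; rewrite mulr_ge0 ?weight_ge0.
    have := ltW (X6 0); rewrite density_law ?enum_uniq // card_Z2 // natrX.
    rewrite ler_pdivlMr ?exprn_gt0 // mulrC; congr (_ * _ <= _).
    by apply: eq_expect => b; rewrite big_enum.
  rewrite sumr_const -[_ *+ #|_|]mulr_natl ler_wpM2r ?exprn_ge0 ?divr_ge0 ?exprn_ge0 //.
  by rewrite ler_nat; apply: subset_leq_card; apply/subsetP => X; rewrite !inE => /andP[].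
rewrite /IC expect_sum.
apply: (@le_trans _ _ (\sum_(C : {set 'I_n} | #|C| == k) (3 / 2 ^+ mx) ^+ k)).
  by apply: ler_sum => C /eqP Ck; rewrite -Ck prob_dependent_on_spread_le.
rewrite sumr_const -[_ *+ #|_|]mulr_natl ler_wpM2r ?exprn_ge0 ?divr_ge0 ?exprn_ge0 //.
rewrite ler_nat -[X in 'C(X, _)]card_ord -cardsT -cards_draws.
by apply: subset_leq_card; apply/subsetP => C; rewrite !inE subsetT.
Qed.
End UnionBound.

(** * Asymptotic estimates and final choice of constants *)

Section Asymptotics.
Variable R : archiRealFieldType.

(** With [y = (1 + x) / 2], one has [x <= y ^+ 2]: one factor [y ^+ n] absorbs [n], the other the
    constant. *)
Lemma mulrn_exprn_small (x c : R) : 0 <= x < 1 -> 0 <= c ->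
  exists n0, forall n, (n0 <= n)%N -> c * n%:R * x ^+ n <= 1.
Proof.
move=> /andP[x0 x1] c0; pose y := (1 + x) / 2.
have [y0 y1 xy] : [/\ 0 < y, y < 1 & x <= y ^+ 2] by rewrite /y; split; nra.
have yi1 : 0 < y^-1 - 1 by rewrite subr_gt0 invf_gt1.
have e0 : 0 < (y^-1 - 1) / (c + 1) by rewrite divr_gt0 //; lra.
have [n0 n0P] := exprn_small (introT andP (conj (ltW y0) y1)) e0.
exists n0.+1 => -[//|n] n0n; have hy := n0P n.+1 (ltnW n0n).
have ny : n.+1%:R * (y^-1 - 1) * y ^+ n.+1 <= 1.
  have := exprn_tangent n (ltW (_ : 0 < y^-1)) ler01.
  rewrite invr_gt0 !expr1n mulr1 exprVn => /(_ y0) h.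
  rewrite -ler_pdivlMr ?exprn_gt0 // div1r; lra.
have yn0 : 0 < y ^+ n.+1 by rewrite exprn_gt0.
have hx : x ^+ n.+1 <= y ^+ n.+1 * y ^+ n.+1.
  by rewrite -expr2 exprAC; apply: lerXn2r; rewrite ?nnegrE ?exprn_ge0 // ltW.
move: hy; rewrite ler_pdivlMr => [hy|]; last by lra.
set N := n.+1%:R in ny *; set Y := y ^+ n.+1 in ny hx hy yn0 *.
have N0 : 0 <= N by rewrite ler0n.
apply: (@le_trans _ _ (c * N * (Y * Y))); first by rewrite ler_wpM2l ?mulr_ge0.
rewrite -(ler_pM2l yi1) mulr1.
have : (N * (y^-1 - 1) * Y) * (c * Y) <= 1 * (c * Y).
  by rewrite ler_wpM2r // mulr_ge0 // ltW.
nra.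
Qed.

(** The least exponent with [2 ^+ n * x > 1] is at least 2, as [x <= 1/2]; take its predecessor. *)
Lemma dyadic_scale (x : R) : 0 < x <= 2^-1 ->
  exists2 m, (0 < m)%N & 2 ^+ m * x <= 1 < 2 ^+ m.+1 * x.
Proof.
move=> /andP[x0 x1].
have [n0 n0P] : exists n0, forall n, (n0 <= n)%N -> 2^-1 ^+ n <= x / 2.
  by apply: exprn_small; lra.
have ex : exists n, 1 < 2 ^+ n * x.
  exists n0; have := n0P n0 (leqnn _).
  rewrite exprVn -[X in X <= _]mul1r ler_pdivrMr ?exprn_gt0 //.
  have : 0 < x * 2 ^+ n0 by rewrite mulr_gt0 ?exprn_gt0.
  rewrite mulrAC; lra.
case: (ex_minnP ex) => [[|[|m]]] hm min_m.
- by move: hm; rewrite expr0 mul1r; lra.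
- by move: hm; rewrite expr1; lra.
exists m.+1 => //; rewrite hm andbT leNgt; apply/negP => /min_m.
by rewrite ltnn.
Qed.
End Asymptotics.

Lemma leq_bin_exp n k : ('C(n, k) <= n ^ k)%N.
Proof.
have h : (n ^_ k <= n ^ k)%N.
  elim: k => // k IHk; rewrite ffactnSr expnSr leq_mul // leq_subr.
  by [].
by apply: leq_trans h; rewrite -bin_ffact leq_pmulr // fact_gt0.
Qed.

Theorem theorem1p1 (R : realType) (p : R) (k : nat) (eps : R) :
  0 < p -> p <= 2^-1 -> (1 <= k)%N -> 0 < eps ->
  exists n0 : nat, forall n : nat, (n0 <= n)%N ->
    prob_corank_ge p n k <= (1 - p + eps) ^+ (k * n).
Proof.
move=> p0 ph k0 eps0; have p_le : p <= 1 - p by lra.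
pose q := 1 - p.
(* The gap from [q] to [w] absorbs exponential losses, that from [w] to [e] polynomial ones. The cap
   [p / 2] keeps [e] below 1. *)
have [w [e [qw we e1 eps_e]]] :
    exists w e, [/\ q < w, w < e, e < 1 & e <= 1 - p + eps].
  pose e1 := Num.min eps (p / 2).
  have [h0 h1 h2] : [/\ 0 < e1, e1 <= eps & e1 <= p / 2].
    by rewrite lt_min ge_min lexx ge_min lexx orbT eps0 divr_gt0.
  by exists (q + e1 / 2), (q + e1); rewrite /q; split; lra.
have q0 : 0 < q by rewrite /q; lra.
have qh : 2^-1 <= q by rewrite /q; lra.
have w0 : 0 < w by lra.
have w1 : w < 1 by lra.
(* The number of sparse vectors, at most [(1 + z) ^+ (2 * n)], then fits between [q ^+ n] and
   [w ^+ n]. *)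
have [z [z0 z1 zw]] : exists z, [/\ 0 < z, z <= 1 & (1 + z) ^+ 2 * q <= w].
  pose z := (w - q) / 3; have z3 : w = q + 3 * z by rewrite /z; lra.
  have z0 : 0 < z by rewrite /z; lra.
  have z1 : z <= 1 by rewrite /z; lra.
  exists z; split=> //; clearbody z.
  have q1 : q <= 1 by lra.
  have zz : z * z <= z by rewrite ler_piMr // ltW.
  have zq : z * q <= z by rewrite ler_piMr // ltW.
  have zzq : z * z * q <= z * z by rewrite ler_piMr // mulr_ge0 // ltW.
  rewrite z3 expr2; lra.
have [D D0 zD] : exists2 D, (0 < D)%N & z^-1 <= (1 + z) ^+ D.
  have [D DP] : exists D, forall m, (D <= m)%N -> (1 + z)^-1 ^+ m <= z.
    by apply: exprn_small => //; rewrite invr_ge0 invf_lt1; lra.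
  exists D.+1 => //; have := DP D.+1 (leqnSn D); rewrite exprVn => h.
  rewrite -[X in _ <= X]invrK lef_pV2 ?posrE ?invr_gt0 ?exprn_gt0 //; lra.
(* The base in the second sum is [2 * th * 6 = w ^+ k / 2]; the spare [2^-1 ^+ n] pays for the
   number of scales. *)
pose th := w ^+ k / 24.
have wk0 : 0 < w ^+ k by rewrite exprn_gt0.
have wk1 : w ^+ k <= 1 by rewrite exprn_ile1 // ltW.
have th0 : 0 < th by rewrite /th; lra.
have th1 : th <= 1 by rewrite /th; lra.
have [d [L [Dd L0 few]]] := few_high_density D p0 p_le qw w1 th0 th1.
pose K := 1 + L + 6 ^+ k.
have six0 : 0 < 6 ^+ k :> R by rewrite exprn_gt0.
have K1 : 1 <= K by rewrite /K; lra.
have e0 : 0 < e by lra.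
have we01 : 0 <= w / e < 1 by rewrite divr_ge0 ?ltW //= ltr_pdivrMr ?mul1r.
have [n1 n1P] := mulrn_exprn_small we01 (le_trans ler01 K1).
have [n2 n2P] : exists n2, forall n, (n2 <= n)%N -> w ^+ n <= 2^-1.
  by apply: exprn_small; lra.
exists (n1 + n2 + k)%N => n hn.
have hn1 : (n1 <= n)%N by apply: leq_trans hn; rewrite -addnA leq_addr.
have hn2 : (n2 <= n)%N by apply: leq_trans hn; rewrite addnAC leq_addl.
have kn : (k <= n)%N by apply: leq_trans hn; rewrite leq_addl.
have n0 : (0 < n)%N by apply: leq_trans kn.
have wn0 : 0 < w ^+ n by rewrite exprn_gt0.
(* The last scale with [2 ^+ mx * w ^+ n <= 1]. By maximality, [3 / 2 ^+ mx] is below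
   [6 * w ^+ n]. *)
have [mx mx0 /andP[mx1 mx2]] : exists2 m, (0 < m)%N &
    2 ^+ m * w ^+ n <= 1 < 2 ^+ m.+1 * w ^+ n.
  by apply: dyadic_scale; rewrite wn0 n2P.
(* Since [w >= 1/2], there are at most [n] scales. *)
have mxn : (mx <= n)%N.
  rewrite -(@ler_eXn2l R 2) ?ltr1n //.
  have : 1 <= 2 ^+ n * w ^+ n by rewrite -exprMn exprn_ege1 //; lra.
  by move=> h; rewrite -(ler_pM2r wn0); apply: le_trans h.
have DdP : (0 < D <= d)%N by rewrite D0 ltnW.
apply: (@le_trans _ _ (e ^+ (k * n))); last first.
  by apply: lerXn2r; rewrite ?nnegrE //; lra.
apply: le_trans (prob_corank_ge_le (ltW p0) p_le DdP mx0 kn) _.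
set W := w ^+ (k * n); have W0 : 0 < W by rewrite exprn_gt0.
have bA : #|sparse n D|%:R ^+ k * (1 - p) ^+ (k * n) <= W.
  have := card_sparse_le (F := 'F_2) n (card_Fp (isT : prime 2)) z0 z1 zD D0.
  move=> /(lerXn2r k (ler0n _ _)) h.
  apply: (@le_trans _ _ (((1 + z) ^+ (2 * n)) ^+ k * q ^+ (k * n))).
    rewrite ler_wpM2r ?exprn_ge0 ?(ltW q0) //; apply: h.
    by rewrite nnegrE exprn_ge0 //; lra.
  have -> : ((1 + z) ^+ (2 * n)) ^+ k = ((1 + z) ^+ 2) ^+ (k * n).
    by rewrite -!exprM -mulnA [(n * k)%N]mulnC.
  rewrite -exprMn; apply: lerXn2r => //; rewrite nnegrE ltW //.
  by rewrite mulr_gt0 ?exprn_gt0 //; lra.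
have bB : \sum_(m < mx.+1 | (0 < m)%N) #|spread p n d m|%:R * (6 / 2 ^+ m) ^+ n <=
    n%:R * L * W.
  have bm (m : 'I_mx.+1) : (0 < m)%N ->
      #|spread p n d m|%:R * (6 / 2 ^+ m) ^+ n <= 2^-1 ^+ n * (L * W).
    move=> m0; have mmx : 2 ^+ m * w ^+ n <= 1.
      apply: le_trans mx1; rewrite ler_wpM2r ?(ltW wn0) // ler_weXn2l ?ler1n //.
      by rewrite -ltnS.
    have c0 : 0 <= (6 / 2 ^+ m) ^+ n :> R by rewrite exprn_ge0 // divr_ge0 ?exprn_ge0.
    apply: le_trans (ler_wpM2r c0 (few n m m0 mmx)) _.
    rewrite -!mulrA -!exprMn [X in _ <= X]mulrCA ler_wpM2l //.
    rewrite [X in X ^+ n](_ : _ = 2^-1 * w ^+ k); last first.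
      by rewrite /th; field; rewrite expf_neq0 ?pnatr_eq0.
    by rewrite exprMn /W exprM.
  apply: le_trans (ler_sum _ bm) _.
  have LW0 : 0 <= L * W by rewrite mulr_ge0 // ltW.
  rewrite -mulr_suml -mulrA ler_wpM2r // sumr_const -[_ *+ _]mulr_natl.
  apply: (@le_trans _ _ (mx.+1%:R * 2^-1 ^+ n)).
    rewrite ler_wpM2r ?exprn_ge0 ?invr_ge0 // ler_nat -[X in (_ <= X)%N]card_ord.
    exact: max_card.
  apply: (@le_trans _ _ (n.+1%:R * 2^-1)).
    apply: ler_pM; rewrite ?ler0n ?exprn_ge0 ?invr_ge0 ?ler_nat //.
    by rewrite -[X in _ <= X]expr1 ler_wiXn2l ?invr_ge0 //; lra.
  have : 1 <= n%:R :> R by rewrite ler1n.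
  rewrite -natr1; lra.
have bC : 'C(n, k)%:R * (3 / 2 ^+ mx) ^+ k <= n%:R ^+ k * 6 ^+ k * W.
  rewrite -mulrA; apply: ler_pM; rewrite ?ler0n ?exprn_ge0 ?divr_ge0 ?exprn_ge0 //.
    by rewrite -natrX ler_nat leq_bin_exp.
  rewrite /W mulnC exprM -exprMn; apply: lerXn2r.
  - by rewrite nnegrE divr_ge0 ?exprn_ge0.
  - by rewrite nnegrE mulr_ge0 ?exprn_ge0 // ltW.
  - by rewrite ler_pdivrMr ?exprn_gt0 //; move: mx2; rewrite exprS; lra.
have nk1 : 1 <= n%:R ^+ k :> R by rewrite exprn_ege1 // ler1n.
have nk2 : n%:R <= n%:R ^+ k :> R by rewrite ler_eXnr // ler1n.
have total : #|sparse n D|%:R ^+ k * (1 - p) ^+ (k * n)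
    + \sum_(m < mx.+1 | (0 < m)%N) #|spread p n d m|%:R * (6 / 2 ^+ m) ^+ n
    + 'C(n, k)%:R * (3 / 2 ^+ mx) ^+ k <= K ^+ k * n%:R ^+ k * W.
  apply: (@le_trans _ _ (K * n%:R ^+ k * W)); last first.
    apply: ler_wpM2r; first exact: ltW.
    by apply: ler_wpM2r; rewrite ?exprn_ge0 // ler_eXnr.
  have := ler_wpM2r (ltW W0) nk1; have := ler_wpM2r (mulr_ge0 L0 (ltW W0)) nk2.
  rewrite /K; lra.
apply: le_trans total _.
(* The [k]-th power of [K * n%:R * (w / e) ^+ n <= 1]. *)
have := n1P n hn1; rewrite exprMn exprVn mulrA ler_pdivrMr ?exprn_gt0 // mul1r.
move=> h; rewrite /W [in w ^+ _]mulnC [in e ^+ _]mulnC !exprM -!exprMn.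
apply: lerXn2r; rewrite ?nnegrE ?mulr_ge0 ?exprn_ge0 ?ler0n ?(ltW w0) ?(ltW e0) //.
exact: le_trans ler01 K1.
Qed.
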